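(* Let $G$ be a connected Lie group, and let $\Sigma_L$ be the linear control system $$\frac{dg}{dt}=\mathcal{X}(g)+\sum_{j=1}^m u_jY_j(g)$$ on $G$, where $\mathcal{X}$ is a linear vector field and $Y_1,\ldots,Y_m$ are right-invariant vector fields. Let $\mathfrak{h}\subseteq\mathfrak{g}$ and $H\subseteq G$ be the associated subalgebra and closed subgroup defined in the context. If $H\subsetneq G$, then $\Sigma_L$ is not controllable on $G$. Equivalently, if $\mathfrak{h}\subsetneq\mathfrak{g}$, then $\Sigma_L$ is not controllable on $G$.
   Context: The Lie algebra $\mathfrak{g}$ of $G$ is the set of right-invariant vector fields. A vector field $\mathcal{X}$ is linear if its flow $\varphi_t$ is a one-parameter group of automorphisms of $G$; its derivation is $\mathcal{D}(Y)=-[\mathcal{X},Y]$, $Y\in\mathfrak{g}$. Controls are piecewise constant functions $u=(u_1,\ldots,u_m):\mathbb{R}\to U\subset\mathbb{R}^m$, and $\phi_t(u,g)$ is the solution of $\Sigma_L$ with control $u$ starting at $g$. $\Sigma_L$ is controllable on $G$ if for all $g,h\in G$ there exist $t\ge 0$ and a control $u$ with $\phi_t(u,g)=h$. Let $\mathfrak{a}=\mathrm{Lie}\{Y_1,\ldots,Y_m\}$ be the Lie subalgebra of $\mathfrak{g}$ generated by $Y_1,\ldots,Y_m$, let $\mathcal{D}\mathfrak{a}=\mathrm{span}\{\mathcal{D}^i(Y): Y\in\mathfrak{a},\ i\in\mathbb{N}\}$ (with $0\in\mathbb{N}$), and let $\mathfrak{h}$ be the Lie subalgebra of $\mathfrak{g}$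 generated by $\mathcal{D}\mathfrak{a}$. $H$ denotes the closed subgroup of $G$ generated by $\mathfrak{h}$ (i.e. by $\exp\mathfrak{h}$), and $\mathfrak{h}$ is taken to be the Lie algebra of $H$. *)

(* Defs.v *)
From HB Require Import structures.
From mathcomp Require Import all_boot all_order all_algebra.
From mathcomp Require Import all_classical all_reals all_analysis.
Set Implicit Arguments.
Unset Strict Implicit.
Unset Printing Implicit Defensive.
Import GRing.Theory Num.Theory.
Import numFieldNormedType.Exports.
Local Open Scope classical_set_scope.
Local Open Scope ring_scope.

(** * Smooth maps on open subsets of normed spaces *)

(* [Ck k U f]: all iterated directional derivatives of [f] of order at most
   [k] exist and are continuous on the open set [U]; in finite dimension this
   is the usual notion of a map of class C^k on [U]. *)
Fixpoint Ck (R : realType) (V W : normedModType R) (k : nat) (U : set V)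
    (f : V -> W) : Prop :=
  (forall x, U x -> {for x, continuous f}) /\
  (if k is k'.+1 then
     forall v : V, (forall x, U x -> derivable f x v) /\
                   Ck k' U (fun x => 'D_v f x)
   else True).

Definition smooth_on (R : realType) (V W : normedModType R) (U : set V)
    (f : V -> W) : Prop :=
  forall k, Ck k U f.

(** * Smooth manifolds of dimension [n] *)

(* The values of [chart_map] outside [chart_dom], and of [chart_inv] outside
   the image of [chart_dom], are irrelevant. *)
Record chart (R : realType) (n : nat) (M : topologicalType) := Chart {
  chart_dom : set M;
  chart_map :> M -> 'rV[R]_n;
  chart_inv : 'rV[R]_n -> M;
  chart_dom_open : open chart_dom;
  chart_im_open : open (chart_map @` chart_dom);
  chart_mapK : forall p, chart_dom p -> chart_inv (chart_map p) = p;
  chart_map_continuous :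
    forall p, chart_dom p -> {for p, continuous chart_map};
  chart_inv_continuous :
    forall x, (chart_map @` chart_dom) x -> {for x, continuous chart_inv}
}.

Definition chart_im (R : realType) (n : nat) (M : topologicalType)
    (c : chart R n M) : set 'rV[R]_n :=
  c @` chart_dom c.

(* [chart_at p] is a preferred chart around [p]; the tangent space at [p] is
   identified with R^n by means of it.  Since chart changes are smooth, this
   choice is immaterial. *)
HB.mixin Record Topological_isManifold (R : realType) (n : nat) M
    of Topological M := {
  atlas : set (chart R n M);
  chart_at : M -> chart R n M;
  chart_at_atlas : forall p, atlas (chart_at p);
  chart_at_dom : forall p, chart_dom (chart_at p) p;
  atlas_compatible : forall c d, atlas c -> atlas d ->
    smooth_on (c @` (chart_dom c `&` chart_dom d)) (d \o chart_inv c);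
  manifold_hausdorff : hausdorff_space M;
  manifold_second_countable : @second_countable M
}.

#[short(type="manifoldType")]
HB.structure Definition Manifold (R : realType) (n : nat) :=
  {M of Topological_isManifold R n M & Topological M}.

Definition smooth_map (R : realType) (n1 n2 : nat) (M : manifoldType R n1)
    (N : manifoldType R n2) (F : M -> N) : Prop :=
  continuous F /\
  forall (c : chart R n1 M) (d : chart R n2 N), atlas c -> atlas d ->
    smooth_on (c @` (chart_dom c `&` F @^-1` chart_dom d))
              (d \o F \o chart_inv c).

(* The tangent map T_pM -> T_(F p)N. *)
Definition tangent_map (R : realType) (n1 n2 : nat) (M : manifoldType R n1)
    (N : manifoldType R n2) (F : M -> N) (p : M) (v : 'rV[R]_n1) : 'rV[R]_n2 :=
  'd (chart_at (F p) \o F \o chart_inv (chart_at p)) (chart_at p p) v.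

(** * Vector fields: [X p : 'rV[R]_n] is a tangent vector at [p] *)

(* The coordinates of [X] in the chart [c]. *)
Definition vf_rep (R : realType) (n : nat) (M : manifoldType R n)
    (X : M -> 'rV[R]_n) (c : chart R n M) (x : 'rV[R]_n) : 'rV[R]_n :=
  let p := chart_inv c x in
  'd (c \o chart_inv (chart_at p)) (chart_at p p) (X p).

Definition smooth_vf (R : realType) (n : nat) (M : manifoldType R n)
    (X : M -> 'rV[R]_n) : Prop :=
  forall c : chart R n M, atlas c -> smooth_on (chart_im c) (vf_rep X c).

(* [X, Y] f = X (Y f) - Y (X f), i.e. DY.X - DX.Y in coordinates. *)
Definition bracket (R : realType) (n : nat) (M : manifoldType R n)
    (X Y : M -> 'rV[R]_n) : M -> 'rV[R]_n := fun p =>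
  let c := chart_at p in
  'd (vf_rep Y c) (c p) (vf_rep X c (c p)) -
  'd (vf_rep X c) (c p) (vf_rep Y c (c p)).

(* gamma'(t) = v, where [v] is a tangent vector at [gamma t]. *)
Definition has_velocity (R : realType) (n : nat) (M : manifoldType R n)
    (gamma : R -> M) (t : R) (v : 'rV[R]_n) : Prop :=
  {for t, continuous gamma} /\
  is_derive t 1 (chart_at (gamma t) \o gamma : R -> 'rV[R]_n) v.

Definition integral_curve (R : realType) (n : nat) (M : manifoldType R n)
    (X : M -> 'rV[R]_n) (gamma : R -> M) : Prop :=
  forall t, has_velocity gamma t (X (gamma t)).

(** * Lie groups *)

HB.mixin Record Manifold_isLieGroup (R : realType) (n : nat) G
    of Manifold R n G & Group G := {
  lie_mul_continuous : continuous (fun z : G * G => (z.1 * z.2)%g);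
  lie_mul_smooth : forall a b c : chart R n G, atlas a -> atlas b -> atlas c ->
    smooth_on [set z : 'rV[R]_n * 'rV[R]_n |
                [/\ chart_im a z.1, chart_im b z.2 &
                    chart_dom c (chart_inv a z.1 * chart_inv b z.2)%g]]
              (fun z => c (chart_inv a z.1 * chart_inv b z.2)%g);
  lie_inv_smooth : smooth_map (fun g : G => g^-1)%g
}.

#[short(type="lieGroupType")]
HB.structure Definition LieGroup (R : realType) (n : nat) :=
  {G of Manifold_isLieGroup R n G & Manifold R n G & Group G}.

Definition subgroup_set (G : groupType) (K : set G) : Prop :=
  K 1%g /\ forall x y, K x -> K y -> K (x / y)%g.

Definition lie_automorphism (R : realType) (n : nat) (G : lieGroupType R n)
    (a : G -> G) : Prop :=
  [/\ {morph a : x y / (x * y)%g}, smooth_map a &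
      exists b : G -> G, [/\ cancel a b, cancel b a & smooth_map b]].

(** * The Lie algebra of right-invariant vector fields *)

Definition right_invariant (R : realType) (n : nat) (G : lieGroupType R n)
    (Y : G -> 'rV[R]_n) : Prop :=
  smooth_vf Y /\
  forall g p : G, tangent_map (fun q : G => (q * g)%g) p (Y p) = Y (p * g)%g.

Definition lie_algebra (R : realType) (n : nat) (G : lieGroupType R n) :
  set (G -> 'rV[R]_n) := @right_invariant R n G.

Definition linear_subspace (R : realType) (V : lmodType R) (L : set V) : Prop :=
  L 0 /\ forall (a : R) (x y : V), L x -> L y -> L (a *: x + y).

Definition lie_subalgebra (R : realType) (n : nat) (G : lieGroupType R n)
    (L : set (G -> 'rV[R]_n)) : Prop :=
  [/\ L `<=` @lie_algebra R n G, linear_subspace L &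
      forall X Y, L X -> L Y -> L (bracket X Y)].

Definition lie_generated (R : realType) (n : nat) (G : lieGroupType R n)
    (S : set (G -> 'rV[R]_n)) : set (G -> 'rV[R]_n) :=
  smallest (@lie_subalgebra R n G) S.

(* exp(Y) is the value at time 1 of the integral curve of [Y] through 1. *)
Definition exp_set (R : realType) (n : nat) (G : lieGroupType R n)
    (S : set (G -> 'rV[R]_n)) : set G :=
  [set g | exists Y gamma, [/\ S Y, integral_curve Y gamma,
                               gamma 0 = 1%g & gamma 1 = g]].

Definition closed_subgroup_generated (R : realType) (n : nat)
    (G : lieGroupType R n) (S : set G) : set G :=
  smallest [set K : set G | closed K /\ subgroup_set K] S.

(* The Lie algebra of a closed subgroup [K]: all [Y] in the Lie algebra of [G]
   such that exp(tY) lies in [K] for all [t]. *)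
Definition lie_algebra_of (R : realType) (n : nat) (G : lieGroupType R n)
    (K : set G) : set (G -> 'rV[R]_n) :=
  [set Y | lie_algebra Y /\
    exists gamma, [/\ integral_curve Y gamma, gamma 0 = 1%g &
                      forall t, K (gamma t)]].

(** * Linear vector fields and linear control systems *)

Definition linear_vf (R : realType) (n : nat) (G : lieGroupType R n)
    (X : G -> 'rV[R]_n) : Prop :=
  smooth_vf X /\
  exists phi : R -> G -> G,
    [/\ forall g, integral_curve X (phi^~ g),
        forall g, phi 0 g = g,
        forall s t g, phi (s + t) g = phi s (phi t g) &
        forall t, lie_automorphism (phi t)].

Definition derivation (R : realType) (n : nat) (G : lieGroupType R n)
    (X Y : G -> 'rV[R]_n) : G -> 'rV[R]_n := - bracket X Y.

(* [s] lists the break points of [u] in [a, b]; the values of [u] at the break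
   points themselves are arbitrary. *)
Definition piecewise_constant (R : realType) (T : Type) (u : R -> T) : Prop :=
  forall a b : R, exists s : seq R, forall x y : R,
    a <= x -> x <= y -> y <= b ->
    (forall z, z \in s -> ~~ (x <= z <= y)) -> u x = u y.

Definition control (R : realType) (m : nat) (U : set 'rV[R]_m)
    (u : R -> 'rV[R]_m) : Prop :=
  piecewise_constant u /\ forall t, U (u t).

(* The right-hand side X + sum_j u_j Y_j for the control value [u]. *)
Definition system_vf (R : realType) (n m : nat) (G : lieGroupType R n)
    (X : G -> 'rV[R]_n) (Y : 'I_m -> G -> 'rV[R]_n) (u : 'rV[R]_m) :
    G -> 'rV[R]_n :=
  fun g => X g + \sum_(j < m) u 0 j *: Y j g.

(* [gamma] is the solution t |-> phi_t(u, gamma 0): it is continuous and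
   satisfies the equation at all times at which [u] does not switch. *)
Definition solution (R : realType) (n m : nat) (G : lieGroupType R n)
    (X : G -> 'rV[R]_n) (Y : 'I_m -> G -> 'rV[R]_n) (u : R -> 'rV[R]_m)
    (gamma : R -> G) : Prop :=
  continuous gamma /\
  forall t, (\forall s \near t, u s = u t) ->
    has_velocity gamma t (system_vf X Y (u t) (gamma t)).

Definition controllable (R : realType) (n m : nat) (G : lieGroupType R n)
    (X : G -> 'rV[R]_n) (Y : 'I_m -> G -> 'rV[R]_n) (U : set 'rV[R]_m) : Prop :=
  forall g h : G, exists (t : R) (u : R -> 'rV[R]_m) (gamma : R -> G),
    [/\ 0 <= t, control U u, solution X Y u gamma, gamma 0 = g & gamma t = h].

(** * The subalgebra and the closed subgroup associated with the system *)

(* a = Lie{Y_1, ..., Y_m} *)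
Definition sub_a (R : realType) (n m : nat) (G : lieGroupType R n)
    (Y : 'I_m -> G -> 'rV[R]_n) : set (G -> 'rV[R]_n) :=
  lie_generated (range Y).

(* Da = span{D^i(Z) : Z in a, i in N} *)
Definition sub_Da (R : realType) (n m : nat) (G : lieGroupType R n)
    (X : G -> 'rV[R]_n) (Y : 'I_m -> G -> 'rV[R]_n) : set (G -> 'rV[R]_n) :=
  smallest (@linear_subspace R (G -> 'rV[R]_n))
    [set W | exists (i : nat) (Z : G -> 'rV[R]_n),
               sub_a Y Z /\ W = iter i (derivation X) Z].

Definition sub_h (R : realType) (n m : nat) (G : lieGroupType R n)
    (X : G -> 'rV[R]_n) (Y : 'I_m -> G -> 'rV[R]_n) : set (G -> 'rV[R]_n) :=
  lie_generated (sub_Da X Y).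

Definition group_H (R : realType) (n m : nat) (G : lieGroupType R n)
    (X : G -> 'rV[R]_n) (Y : 'I_m -> G -> 'rV[R]_n) : set G :=
  closed_subgroup_generated (exp_set (sub_h X Y)).

(* Main.v *)
(** Let K be the closed subgroup generated by exp(Da), where Da is the D-invariant
    span; K is contained in H.  At the fixed point 1 of its flow phi_t, the
    linearization of X is D under the identification Y |-> Y(1), so the
    differential of phi_t at 1 preserves Da and phi_t(K) is contained in K for
    t >= 0.  For q in K and Z in Da, the curve exp(tZ) phi_t(q) lies in K and has
    velocity X(q) + Z(q) at t = 0.  The right-hand sides of the system are of this
    form, so by Nagumo's theorem solutions starting at 1 stay in K, hence in H.

    If H = G, then h = g because right-invariant vector fields are complete.  If
    h = g, then every tangent vector at a point of H is the velocity of a curve in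
    H; Nagumo's theorem applied to straight lines in charts shows that H is open,
    so H = G by connectedness. *)

Require Import Defs.
From HB Require Import structures.
From mathcomp Require Import all_boot all_order all_algebra.
From mathcomp Require Import all_classical all_reals all_analysis.
From mathcomp Require Import zify ring lra.
Set Implicit Arguments.
Unset Strict Implicit.
Unset Printing Implicit Defensive.
Import Order.TTheory GRing.Theory Num.Theory.
Import numFieldNormedType.Exports.
Local Open Scope classical_set_scope.
Local Open Scope ring_scope.

(** * Differential inequalities *)

(** The group [K] is known only as a smallest closed subgroup, so no submanifold structure on it is
    available. Tangency is therefore expressed by curves that stay in the set for small positive
    times, and trapping is proved by estimating the distance to the set. That distance is merely
    Lipschitz, which is why Gronwall's inequality is stated for right difference quotients. The
    expected formula for the differential of [phi_t] at 1 is [exp(tD)], but no linear equation is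
    solved. In coordinates [C] with kernel [Da(1)], Gronwall shows that a curve leaving 1 in a
    direction of [Da(1)] is carried by [phi_t] to a curve whose transverse part is of smaller than
    first order. Only forward times enter, and they suffice because tangency concerns positive
    times. Identities between differentials (chart changes, translations, automorphisms) are
    obtained by computing the velocity of one curve in two ways. Constants are not sharp: what
    matters is that they are finite, or that the bound vanishes with the initial error. *)

Lemma real_induction (R : realType) (a b : R) (P : R -> Prop) :
  (forall t, a <= t <= b -> (forall s, a <= s < t -> P s) -> P t) ->
  (forall t, a <= t < b -> (forall s, a <= s <= t -> P s) ->
     exists2 e, 0 < e & forall s, t < s < t + e -> s <= b -> P s) ->
  forall t, a <= t <= b -> P t.
Proof.
move=> Pleft Pright t1 t1ab; apply: contrapT => nPt1.
(* The infimum of the failures satisfies [P] by the first hypothesis, and the second one then pushes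
   failures away from it. At [t = a] the first hypothesis is the base case, its premise being
   void. *)
pose S := [set s | a <= s <= b /\ ~ P s].
have S_inf : has_inf S.
  by split; [exists t1 | exists a => s [/andP[]]].
have infS_le s : S s -> inf S <= s by move=> Ss; apply: ge_inf => //; case: S_inf.
have Pbelow s : a <= s -> s <= b -> s < inf S -> P s.
  move=> sa sb sS; apply: contrapT => nPs.
  by move: sS; rewrite ltNge infS_le //; split => //; rewrite sa.
have S1 : S t1 by [].
have aS : a <= inf S by apply: lb_le_inf; [case: S_inf | move=> s [/andP[]]].
have Sb : inf S <= b by rewrite (le_trans (infS_le _ S1)) //; case/andP: t1ab.
have PS : P (inf S).
  apply: Pleft; first by rewrite aS.
  by move=> s /andP[sa sS]; apply: Pbelow => //; rewrite (le_trans (ltW sS)).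
have S_lt : inf S < b.
  have : inf S < t1.
    by rewrite lt_neqAle infS_le // andbT; apply/eqP => E; rewrite E in PS.
  by move=> /lt_le_trans; apply; case/andP: t1ab.
have [|s /andP[sa sS]|e e0 Pe] := Pright (inf S).
- by rewrite aS.
- by move: sS; rewrite le_eqVlt => /predU1P[->//|sS]; apply: Pbelow => //;
    rewrite (le_trans (ltW sS)).
have [s Ss sS] := inf_adherent e0 S_inf.
have [/andP[sa sb] nPs] := Ss.
have : inf S <= s by exact: infS_le.
rewrite le_eqVlt => /predU1P[E|Ss']; first by apply: nPs; rewrite -E.
by apply: nPs; apply: Pe => //; rewrite Ss'.
Qed.

Lemma gronwall (R : realType) (E : R -> R) (C b e0 T : R) :
  0 <= C -> 0 <= b -> 0 <= e0 ->
  (forall t, 0 <= t <= T -> {for t, continuous E}) -> E 0 <= e0 ->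
  (forall t, 0 < t < T -> forall e, 0 < e ->
     \forall h \near 0^'+, E (t + h) <= E t + h * (C * E t + b + e)) ->
  forall t, 0 <= t <= T -> E t <= (e0 + b) * expR ((C + 1) * t).
Proof.
move=> C0 b0 e00 cE E0 dE.
suff H n : 0 < n -> forall t, 0 <= t <= T ->
    E t <= (e0 + b + n) * expR ((C + 1) * t).
  move=> t tT; apply/ler_addgt0Pr => e e1.
  have /(_ t tT)/le_trans := H (e / expR ((C + 1) * t)) (divr_gt0 e1 (expR_gt0 _)).
  by apply; rewrite [_ * expR _]mulrDl -mulrA mulVf ?mulr1 // gt_eqF ?expR_gt0.
(* Since [g] stays above [e0 + b + n], its derivative [(C + 1) * g] dominates [C * g + b + n]. The
   extra 1 in the rate thus absorbs the constant terms without dividing by [C], which may be 0. *)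
move=> n0; pose g t := (e0 + b + n) * expR ((C + 1) * t).
have g0 : 0 < e0 + b + n by lra.
have gS t h : 0 <= h -> g t * (1 + (C + 1) * h) <= g (t + h).
  move=> h0; rewrite /g [(C + 1) * (t + h)]mulrDr expRD mulrA.
  by rewrite ler_pM2l ?mulr_gt0 ?expR_gt0 // expR_ge1Dx.
have gge t : 0 <= t -> e0 + b + n <= g t.
  move=> t0; rewrite /g ler_peMr ?(ltW g0) //.
  by rewrite -[leLHS]expR0 ler_expR mulr_ge0 //; lra.
have cg t : {for t, continuous g}.
  apply: cvgM; first exact: cvg_cst.
  apply: (@continuous_comp _ _ _ (fun t => (C + 1) * t)); last exact: continuous_expR.
  exact: mulrl_continuous.
apply: real_induction => t /andP[t0 tT] IH.
- move: t0; rewrite le_eqVlt => /predU1P[<-|t0].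
    by have := gge 0 (lexx _); rewrite /g; lra.
  rewrite leNgt; apply/negP => gE.
  have c : {for t, continuous (E \- g)}.
    by apply: cvgB; [apply: cE; rewrite (ltW t0)|exact: cg].
  have : \forall s \near t^'-, 0 < (E \- g) s.
    by apply: (cvgr_gt _ (cvg_at_left_filter c)); rewrite /= subr_gt0.
  move=> H; near t^'- => s.
  have : 0 < (E \- g) s by near: s.
  rewrite /= subr_gt0 ltNge IH //; apply/andP; split; near: s.
    exact: nbhs_left_ge.
  exact: nbhs_left_lt.
have {IH}Et : E t <= g t by apply: IH; rewrite t0 lexx.
suff : \forall h \near 0^'+, E (t + h) <= (e0 + b + n) * expR ((C + 1) * (t + h)).
  move=> /nbhs_ballP[d /= d0 db]; exists d => // s /andP[ts st] _.
  have -> : s = t + (s - t) by lra.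
  apply: db; last by rewrite subr_gt0.
  by rewrite /ball /= sub0r normrN ger0_norm; lra.
(* The differential inequality is not assumed at 0. There the slack [n] makes [E 0 < g 0] strict and
   continuity carries the comparison to the right. *)
move: t0; rewrite le_eqVlt => /predU1P[t0|t0].
  have Eg : E 0 < g 0 by have := gge 0 (lexx _); lra.
  have c : {for t, continuous (fun s => g s - E s)}.
    by apply: cvgB; [exact: cg|apply: cE; rewrite (ltW tT) -t0 lexx].
  have : \forall s \near t, 0 < g s - E s.
    by apply: (cvgr_gt _ c); rewrite subr_gt0 -t0.
  rewrite -t0 near_withinE; apply: filterS => s.
  by rewrite subr_gt0 add0r => /ltW.
near=> h.
have h0 : 0 < h by near: h; exact: nbhs_right_gt.
have /le_trans : E (t + h) <= E t + h * (C * E t + b + n).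
  by near: h; apply: dE => //; rewrite t0.
apply; apply: le_trans (gS t h (ltW h0)).
have := gge t (ltW t0) => H1.
have H2 : C * E t <= C * g t by rewrite ler_wpM2l.
have H3 : h * (C * E t + b + n) <= h * (C * g t + g t).
  by rewrite ler_wpM2l ?(ltW h0) //; lra.
by move: (g t) Et H3 => gt Et; lra.
Unshelve. all: by end_near. Qed.

Lemma is_derive_dist (R : realType) (V W : normedModType R) (f : V -> W)
    (x v : V) (d : W) :
  is_derive x v f d <->
  forall e, 0 < e ->
    \forall h \near (0 : R), `|f (h *: v + x) - f x - h *: d| <= e * `|h|.
Proof.
split=> [[df <-] e e0|H].
  have /derivable_nbhs/eqaddoP/(_ e e0) := df.
  by apply: filterS => h /=; rewrite opprD addrA.
have H' : (fun h => h^-1 *: ((f \o shift x) (h *: v) - f x)) @ 0^' --> d.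
  apply/cvgrPdist_le => e e0.
  rewrite near_withinE; apply: filterS (H e e0) => h he hN0 /=.
  rewrite distrC -[X in _ - X](scale1r d) -(mulVf hN0) -scalerA -scalerBr.
  by rewrite normrZ normfV ler_pdivrMl ?normr_gt0 // mulrC.
split; first by apply/cvg_ex; exists d.
exact: cvg_lim.
Qed.

Lemma is_derive1_dist (R : realType) (W : normedModType R) (f : R -> W)
    (t : R) (d : W) :
  is_derive t 1 f d <->
  forall e, 0 < e ->
    \forall h \near (0 : R), `|f (t + h) - f t - h *: d| <= e * `|h|.
Proof.
have hE (h : R) : h *: (1 : R^o) + t = t + h by rewrite [_ *: _]mulr1 addrC.
by split=> [/is_derive_dist H e e0|H]; [|apply/is_derive_dist => e e0];
  apply: filterS (H e e0) => h; rewrite hE.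
Qed.

Lemma is_derive1_continuous (R : realType) (W : normedModType R) (f : R -> W)
    (t : R) (d : W) :
  is_derive t 1 f d -> {for t, continuous f}.
Proof. by case=> /derivable1_diffP /differentiable_continuous. Qed.

(** The norm of [f] need not be differentiable, but by the triangle inequality its right difference
    quotients exceed the norm of [df t] by at most any given [e]. *)
Lemma gronwall_norm (R : realType) (W : normedModType R) (f df : R -> W)
    (C b T : R) :
  0 <= C -> 0 <= b ->
  (forall t, 0 <= t <= T -> {for t, continuous f}) ->
  (forall t : R, 0 < t < T -> is_derive t 1 f (df t)) ->
  (forall t, 0 < t < T -> `|df t| <= C * `|f t| + b) ->
  forall t, 0 <= t <= T -> `|f t| <= (`|f 0| + b) * expR ((C + 1) * t).
Proof.
move=> C0 b0 cf fd dfb.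
apply: (@gronwall R (fun t => `|f t|)) => // [t tT|t tT e e0].
  by apply: (@continuous_comp _ _ _ f); [exact: cf|exact: norm_continuous].
have /is_derive1_dist /(_ e e0) := fd t tT.
rewrite near_withinE; apply: filterS => h H h0.
rewrite (ger0_norm (ltW h0)) in H.
have -> : f (t + h) = (f (t + h) - f t - h *: df t) + f t + h *: df t.
  by rewrite -[RHS]addrA -[_ - f t - _]addrA -opprD subrK.
rewrite (le_trans (ler_normD _ _)) // (le_trans (lerD (ler_normD _ _) (lexx _))) //.
rewrite normrZ (ger0_norm (ltW h0)).
by have := ler_wpM2l (ltW h0) (dfb t tT); lra.
Qed.

(** Gronwall with [C = 0] applied to [f - f 0] replaces a mean value theorem for vector values. The
    factor [expR 1] is the growth at rate [C + 1 = 1] over the unit interval. *)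
Lemma mean_value_bound (R : realType) (W : normedModType R) (f : R -> W)
    (df : R -> W) (M : R) :
  (forall t : R, 0 <= t <= 1 -> is_derive t 1 f (df t)) ->
  (forall t : R, 0 <= t <= 1 -> `|df t| <= M) ->
  `|f 1 - f 0| <= expR 1 * M.
Proof.
move=> fd dM.
have M0 : 0 <= M by apply: le_trans (dM 0 _); rewrite ?lexx ?ler01.
pose g t := f t - f 0.
have gd (t : R) : 0 <= t <= 1 -> is_derive t 1 g (df t).
  move=> /fd /is_derive1_dist H; apply/is_derive1_dist => e /H.
  by apply: filterS => h; rewrite /g opprB [_ - f 0 + _]addrA subrK.
have -> : expR 1 * M = (`|g 0| + M) * expR ((0 + 1) * 1).
  by rewrite /g subrr normr0 !add0r mulr1 mulrC.
have H := @gronwall_norm _ _ g df 0 M 1 (lexx _) M0.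
apply: H; rewrite ?lexx ?ler01 //.
- by move=> t /gd; exact: is_derive1_continuous.
- by move=> t /andP[/ltW t0 /ltW t1]; apply: gd; rewrite t0.
- by move=> t /andP[/ltW t0 /ltW t1]; rewrite mul0r add0r dM // t0.
Qed.

(** * Maps of class C^1 *)

Lemma linear_rV_continuous (R : realType) (n : nat) (W : normedModType R)
    (f : {linear 'rV[R]_n -> W}) : continuous f.
Proof.
have -> : (f : _ -> _) = fun v => \sum_(i < n) v 0 i *: f (delta_mx 0 i).
  apply/funext => v; rewrite {1}[v]row_sum_delta linear_sum.
  by apply: eq_bigr => i _; rewrite linearZ.
apply: continuous_big => [|i _ v]; first exact: add_continuous.
by apply: cvgZr_tmp; [exact: (nbhs_filter v)|exact: coord_continuous].
Qed.

(* Strict differentiability along [v]: the estimate is uniform in the base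
   point, so increments along several directions can be added up. *)
Lemma derive_strict (R : realType) (V W : normedModType R) (f : V -> W)
    (U : set V) (x v : V) :
  open U -> U x -> (forall y, U y -> derivable f y v) ->
  {for x, continuous (fun y => 'D_v f y)} ->
  forall e, 0 < e -> exists2 d : R, 0 < d & forall y h,
    `|y - x| <= d -> `|h| <= d ->
    `|f (h *: v + y) - f y - h *: 'D_v f x| <= e * `|h|.
Proof.
move=> oU Ux df cDf e e0.
have e1 : 0 < e / expR 1 by rewrite divr_gt0 ?expR_gt0.
have [d d0 dP] : exists2 d : R, 0 < d & forall y, `|y - x| < d ->
    U y /\ `|'D_v f y - 'D_v f x| <= e / expR 1.
  have /nbhs_ballP[d /= d0 dP] : \forall y \near x,
      U y /\ `|'D_v f y - 'D_v f x| <= e / expR 1.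
    apply: filterI; first exact: open_nbhs_nbhs.
    move/cvgrPdist_le : cDf => /(_ _ e1); apply: filterS => y.
    by rewrite distrC.
  exists d => // y yx; apply: dP.
  by rewrite -ball_normE /= distrC.
have v0 : 0 < 1 + `|v| by rewrite ltr_pwDl.
(* With this radius the base point moves by at most [d / 2] and the increment [h *: v] by less than
   [d / 2], so the whole segment stays in the ball of radius [d]. *)
exists (d / 2 / (1 + `|v|)); first by rewrite !divr_gt0.
move=> y h yx hd.
have {}yx : `|y - x| <= d / 2.
  apply: le_trans yx _; rewrite ler_pdivrMr // ler_peMr ?lerDl //.
  by rewrite ltW // divr_gt0.
have hv : `|h| * `|v| < d / 2.
  rewrite ler_pdivlMr // in hd; have [->|hN0] := eqVneq h 0.
    by rewrite normr0 mul0r divr_gt0.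
  by apply: lt_le_trans hd; rewrite ltr_pM2l ?normr_gt0 // ltrDr.
have near_x t : 0 <= t <= 1 -> U ((t * h) *: v + y) /\
    `|'D_v f ((t * h) *: v + y) - 'D_v f x| <= e / expR 1.
  move=> /andP[t0 t1]; apply: dP; rewrite -addrA (le_lt_trans (ler_normD _ _)) //.
  rewrite [ltRHS]splitr ltr_leD // (le_lt_trans _ hv) // normrZ normrM.
  by rewrite (ger0_norm t0) -mulrA ler_piMl // mulr_ge0.
(* Subtracting the expected linear growth leaves a function on the segment whose derivative is [h]
   times the small oscillation of the directional derivative. Dividing [e] by [expR 1] above
   compensates the mean value constant. *)
pose g (t : R) := f ((t * h) *: v + y) - (t * h) *: 'D_v f x.
pose dg (t : R) := h *: ('D_v f ((t * h) *: v + y) - 'D_v f x).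
have -> : f (h *: v + y) - f y - h *: 'D_v f x = g 1 - g 0.
  by rewrite /g !mul0r !scale0r !mul1r add0r subr0 addrAC.
have -> : e * `|h| = expR 1 * (`|h| * (e / expR 1)).
  by rewrite mulrCA [expR 1 * _]mulrC mulfVK ?gt_eqF ?expR_gt0 // mulrC.
apply: (@mean_value_bound _ _ g dg) => t t01; last first.
  by rewrite normrZ ler_wpM2l //; case: (near_x t t01).
have [Ut _] := near_x t t01.
have /derivableP /is_derive_dist dft := df _ Ut.
apply/is_derive1_dist => e' e'0.
have h1 : 0 < 1 + `|h| by rewrite ltr_pwDl.
have /nbhs_ballP[r /= r0 rP] := dft _ (divr_gt0 e'0 h1).
apply/nbhs_ballP; exists (r / (1 + `|h|)) => /= [|s]; first exact: divr_gt0.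
rewrite /ball /= sub0r normrN => sr.
have shr : `|s * h| < r.
  rewrite normrM; apply: le_lt_trans (_ : `|s| * (1 + `|h|) < r).
    by rewrite ler_wpM2l // lerDr.
  by rewrite -ltr_pdivlMr.
have := rP (s * h); rewrite /ball /= sub0r normrN => /(_ shr) H.
rewrite /g /dg [(t + s) * h]mulrDl !scalerDl.
rewrite (_ : _ - _ = f ((s * h) *: v + ((t * h) *: v + y)) -
  f ((t * h) *: v + y) - (s * h) *: 'D_v f ((t * h) *: v + y)).
  apply: le_trans H _; rewrite normrM.
  have -> : e' / (1 + `|h|) * (`|s| * `|h|) = e' * `|s| * (`|h| / (1 + `|h|)) by ring.
  rewrite ler_piMr ?mulr_ge0 ?(ltW e'0) //.
  by rewrite ler_pdivrMr // mul1r lerDr.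
rewrite [(s * h) *: v + _]addrCA [(t * h) *: v + (_ + y)]addrA scalerA scalerBr.
rewrite !opprB opprD -!addrA; congr (_ + _).
by rewrite [- ((s * h) *: _) + _]addrCA addKr addrCA addKr.
Qed.

Lemma dist_differentiable (R : realType) (V W : normedModType R)
    (f : V -> W) (df : {linear V -> W}) (x : V) :
  continuous df ->
  (forall e, 0 < e ->
     \forall v \near (0 : V), `|f (v + x) - f x - df v| <= e * `|v|) ->
  differentiable f x.
Proof.
move=> cdf H.
have E : f \o shift x = cst (f x) + df +o_ 0 id.
  apply/eqaddoP => e e0; apply: filterS (H e e0) => v /=.
  by rewrite opprD addrA.
by apply/diff_locallyP; rewrite (diff_unique cdf E).
Qed.

Lemma differentiable_dist (R : realType) (V W : normedModType R)
    (f : V -> W) (x : V) :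
  differentiable f x -> forall e, 0 < e ->
     \forall v \near (0 : V), `|f (v + x) - f x - 'd f x v| <= e * `|v|.
Proof.
move=> /diff_locally /eqaddoP H e e0; apply: filterS (H e e0) => v /=.
by rewrite opprD addrA.
Qed.

Lemma rV_coord_le (R : realType) (n : nat) (v : 'rV[R]_n) i : `|v 0 i| <= `|v|.
Proof.
rewrite [leRHS]/Num.norm /= mx_normrE.
exact: (le_bigmax_cond _ (fun i : 'I_1 * 'I_n => `|v i.1 i.2|) (j := (0, i))).
Qed.

Lemma rV_norm_le (R : realType) (n : nat) (v : 'rV[R]_n) (M : R) :
  0 <= M -> (forall i, `|v 0 i| <= M) -> `|v| <= M.
Proof.
move=> M0 vM; rewrite [leLHS]/Num.norm /= mx_normrE.
by apply/bigmax_leP; split=> // -[a j] _ /=; rewrite (ord1 a).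
Qed.

Lemma C1_differentiable (R : realType) (n : nat) (W : normedModType R)
    (U : set 'rV[R]_n) (f : 'rV[R]_n -> W) (x : 'rV[R]_n) :
  open U -> U x -> Ck 1 U f -> differentiable f x.
Proof.
move=> oU Ux [_ C1].
pose D i := 'D_(delta_mx 0 i : 'rV[R]_n) f x.
pose df (v : 'rV[R]_n) : W := \sum_(i < n) v 0 i *: D i.
have df_lin : linear df.
  move=> a u v; rewrite /df scaler_sumr -big_split; apply: eq_bigr => i _ /=.
  by rewrite !mxE scalerDl scalerA.
pose dfL : {linear 'rV[R]_n -> W} :=
  HB.pack df (GRing.isLinear.Build R 'rV[R]_n W *:%R df df_lin).
have cdf : continuous dfL by exact: linear_rV_continuous.
apply: (dist_differentiable cdf) => e e0.
(* The error is shared among [n] coordinate steps; the 1 keeps the denominator positive when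
   [n = 0]. *)
have e1 : 0 < e / (1 + n%:R) by rewrite divr_gt0 // ltr_pwDl.
have dP (i : 'I_n) : exists2 d : R, 0 < d & forall y h,
    `|y - x| <= d -> `|h| <= d ->
    `|f (h *: delta_mx 0 i + y) - f y - h *: D i| <= e / (1 + n%:R) * `|h|.
  have [der [cder _]] := C1 (delta_mx 0 i).
  by apply: (derive_strict oU Ux der) => //; exact: cder.
have {dP}[d d0 dP] : exists2 d : R, 0 < d & forall (i : 'I_n) y h,
    `|y - x| <= d -> `|h| <= d ->
    `|f (h *: delta_mx 0 i + y) - f y - h *: D i| <= e / (1 + n%:R) * `|h|.
  have H : \forall d \near (0 : R)^'+, forall (i : 'I_n) y h,
      `|y - x| <= d -> `|h| <= d ->
      `|f (h *: delta_mx 0 i + y) - f y - h *: D i| <= e / (1 + n%:R) * `|h|.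
    apply: filter_forall => i; have [d d0 iP] := dP i; near=> d' => y h yx hd.
    have d'd : d' <= d by near: d'; exact: nbhs_right_le.
    by apply: iP; [exact: le_trans yx d'd|exact: le_trans hd d'd].
  by near (0 : R)^'+ => d; exists d; [|near: d].
(* The path from [x] to [v + x] switches on one coordinate of [v] at a time. The increment of [f]
   telescopes along it, and each step is a strict estimate at a base point near [x]. *)
pose p (v : 'rV[R]_n) k : 'rV[R]_n := \row_j (if (j < k)%N then v 0 j else 0).
have p_norm v k : `|p v k| <= `|v|.
  apply: rV_norm_le => // j; rewrite mxE; case: ifP => _; first exact: rV_coord_le.
  by rewrite normr0.
have pS v (i : 'I_n) : p v i.+1 = v 0 i *: delta_mx 0 i + p v i.
  apply/rowP => j; rewrite !mxE eqxx /= ltnS leq_eqVlt.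
  have [->|ji] := eqVneq j i; first by rewrite eqxx ltnn mulr1 addr0.
  by rewrite val_eqE (negbTE ji) mulr0 add0r.
apply/nbhs_ballP; exists d => //= v; rewrite -ball_normE /= sub0r normrN => vd.
have pn : p v n = v by apply/rowP => j; rewrite mxE ltn_ord.
have p0 : p v 0 = 0 by apply/rowP => j; rewrite !mxE.
rewrite -{1}pn -{2}[x]add0r -p0.
rewrite -(@telescope_sumr _ 0 n (fun k => f (p v k + x))) // big_mkord.
rewrite /df -sumrB; apply: le_trans (ler_norm_sum _ _ _) _.
apply: (@le_trans _ _ (\sum_(i < n) e / (1 + n%:R) * `|v|)).
  apply: ler_sum => i _; rewrite pS -[_ *: delta_mx _ _ + _ + x]addrA.
  have /le_trans : `|f (v 0 i *: delta_mx 0 i + (p v i + x)) - f (p v i + x) - v 0 i *: D i|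
      <= e / (1 + n%:R) * `|v 0 i|.
    apply: dP; first by rewrite addrK (le_trans (p_norm _ _)) // ltW.
    by rewrite (le_trans (rV_coord_le _ _)) // ltW.
  by apply; rewrite ler_wpM2l ?(ltW e1) // rV_coord_le.
rewrite sumr_const card_ord -mulrnAl ler_wpM2r // -[_ *+ n]mulr_natr -mulrA ler_piMr ?ltW //.
by rewrite mulrC ltr_pdivrMr ?ltr_pwDl // mul1r ltrDr.
Unshelve. all: by end_near. Qed.

Lemma is_derive1_comp_diff (R : realType) (V W : normedModType R) (f : V -> W)
    (g : R -> V) (t : R) (w : V) :
  is_derive t 1 g w -> differentiable f (g t) ->
  is_derive t 1 (f \o g) ('d f (g t) w).
Proof.
move=> [/derivable1_diffP dg <-] df.
have dfg : differentiable (f \o g) t by exact: differentiable_comp.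
split; first exact/derivable1_diffP.
by rewrite !deriveE // diff_comp.
Qed.

Lemma is_derive1_line (R : realType) (V : normedModType R) (v z : V) (t : R) :
  is_derive t 1 (fun s : R => s *: v + z) v.
Proof.
apply/is_derive1_dist => e e0.
have H h : `|(t + h) *: v + z - (t *: v + z) - h *: v| <= e * `|h|.
  rewrite scalerDl opprD addrACA subrr addr0 [_ *: v + _]addrC addrK subrr.
  by rewrite normr0 mulr_ge0 // ltW.
by apply: filterS (filterT : nbhs (0 : R) setT) => h _; exact: H.
Qed.

Lemma Ck_ext (R : realType) (V W : normedModType R) k (U : set V)
    (f g : V -> W) :
  open U -> (forall x, U x -> f x = g x) -> Ck k U f -> Ck k U g.
Proof.
move=> oU; elim: k f g => [|k IH] f g fg.
all: have fg_near x : U x -> \near x, f x = g x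
  by move=> Ux; apply: filterS (open_nbhs_nbhs (conj oU Ux)) => y; exact: fg.
all: have cont (h1 h2 : V -> W) : (forall x, U x -> h1 x = h2 x) ->
    (forall x, U x -> {for x, continuous h1}) ->
    forall x, U x -> {for x, continuous h2}
  by move=> h12 ch1 x Ux; suff : h2 @ x --> h1 x; first (by rewrite (h12 x Ux));
    apply: cvg_trans (ch1 x Ux); apply: near_eq_cvg;
    apply: filterS (open_nbhs_nbhs (conj oU Ux)) => y; exact: h12.
  by move=> [cf _]; split => //; exact: cont fg cf.
move=> [cf df]; split=> [|v]; first exact: cont fg cf.
have [derf cdf] := df v; split=> [x Ux|].
  exact: near_eq_derivable (fg_near x Ux) (derf x Ux).
apply: IH cdf => x Ux; exact: near_eq_derive (fg_near x Ux).
Qed.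

(** For a continuous affine [i] with linear part [A], the difference quotients of [f \o i] along [v]
    are literally those of [f] along [A v]. No chain rule is needed, so the induction on [k] needs
    only directional derivatives. *)
Lemma Ck_affine (R : realType) (V' V W : normedModType R) k (U : set V)
    (f : V -> W) (i A : V' -> V) :
  continuous i -> (forall (h : R) v x, i (h *: v + x) = h *: A v + i x) ->
  Ck k U f -> Ck k (i @^-1` U) (f \o i).
Proof.
move=> ci iA; elim: k f => [|k IH] f [cf df]; split=> //.
- by move=> x Ux; apply: continuous_comp; [exact: ci|exact: cf].
- by move=> x Ux; apply: continuous_comp; [exact: ci|exact: cf].
have E v : (fun x (h : R) => h^-1 *: (((f \o i) \o shift x) (h *: v) - (f \o i) x)) =
    fun x h => h^-1 *: ((f \o shift (i x)) (h *: A v) - f (i x)).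
  by apply/funext => x; apply/funext => h /=; rewrite iA.
move=> v; have [derf cdf] := df (A v); split=> [x Ux|].
  by rewrite /derivable (congr1 (fun F => F x) (E v)); exact: derf.
have -> : (fun x => 'D_v (f \o i) x) = (fun x => 'D_(A v) f x) \o i.
  by apply/funext => x; rewrite /= /derive (congr1 (fun F => F x) (E v)).
exact: IH.
Qed.

(** Continuity bounds the partial derivatives near [x], and the mean value bound along segments,
    which stay in the convex ball, turns this into a Lipschitz constant. Closed balls are obtained
    by halving the radius. *)
Lemma smooth_on_lipschitz (R : realType) (n : nat) (W : normedModType R)
    (U : set 'rV[R]_n) (f : 'rV[R]_n -> W) (x : 'rV[R]_n) :
  open U -> U x -> Ck 1 U f ->
  exists r L : R, [/\ 0 < r, 0 <= L, forall y, `|y - x| <= r -> U y &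
    forall y z, `|y - x| <= r -> `|z - x| <= r -> `|f y - f z| <= L * `|y - z|].
Proof.
move=> oU Ux C1; have [_ C1'] := C1.
pose D i y := 'D_(delta_mx 0 i : 'rV[R]_n) f y.
have /nbhs_ballP[r /= r0 rP] : \forall y \near x, U y /\ forall i, `|D i y| <= 1 + `|D i x|.
  apply: filterI; first exact: open_nbhs_nbhs.
  apply: (@filter_forall _ _ (fun i y => `|D i y| <= 1 + `|D i x|) (nbhs x)) => i.
  have [_ [cD _]] := C1' (delta_mx 0 i).
  have /cvgrPdist_le /(_ 1 ltr01) := cD x Ux; apply: filterS => y H.
  rewrite -[D i y](subrK (D i x)) (le_trans (ler_normD _ _)) // lerD2r.
  by rewrite distrC.
pose M := \sum_(i < n) (1 + `|D i x|).
have M0 : 0 <= M by apply: sumr_ge0 => i _; rewrite addr_ge0.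
have {}rP y : `|y - x| <= r / 2 -> U y /\ forall i, `|D i y| <= 1 + `|D i x|.
  move=> yx; apply: rP; rewrite -ball_normE /= distrC (le_lt_trans yx) //.
  by rewrite ltr_pdivrMr // ltr_pMr // ltr1n.
exists (r / 2), (expR 1 * M); split.
- by rewrite divr_gt0.
- by rewrite mulr_ge0 // ltW // expR_gt0.
- by move=> y /rP[].
move=> y z yx zx.
pose p (t : R) := t *: (y - z) + z.
have pE t : p t - x = t *: (y - x) + (1 - t) *: (z - x).
  rewrite /p scalerBl scale1r [RHS]addrCA -scalerBr opprB addrA subrK.
  by rewrite -addrA addrC.
have px t : 0 <= t <= 1 -> `|p t - x| <= r / 2.
  move=> /andP[t0 t1]; rewrite pE (le_trans (ler_normD _ _)) // !normrZ.
  rewrite (ger0_norm t0) ger0_norm ?subr_ge0 //.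
  have -> : r / 2 = t * (r / 2) + (1 - t) * (r / 2) by lra.
  by rewrite lerD // ler_wpM2l // subr_ge0.
have -> : f y - f z = (f \o p) 1 - (f \o p) 0.
  by rewrite /= /p scale1r scale0r add0r subrK.
rewrite -mulrA.
apply: (@mean_value_bound _ _ (f \o p) (fun t => 'd f (p t) (y - z))) => t t01.
  apply: is_derive1_comp_diff; last exact: C1_differentiable oU (rP _ (px t t01)).1 C1.
  exact: is_derive1_line.
have df : differentiable f (p t) by exact: C1_differentiable oU (rP _ (px t t01)).1 C1.
rewrite {1}[y - z]row_sum_delta linear_sum mulr_suml.
apply: le_trans (ler_norm_sum _ _ _) _; apply: ler_sum => i _.
rewrite linearZ normrZ mulrC ler_pM ?rV_coord_le //.
by rewrite -deriveE //; apply: (rP _ (px t t01)).2.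
Qed.

(** * Invariant sets and local existence for differential equations *)

Lemma norm_sub_continuous (R : realType) (V : normedModType R) (a : V) :
  continuous (fun y : V => `|a - y|).
Proof.
move=> y; apply: (@continuous_comp _ _ _ (fun y => a - y)); last exact: norm_continuous.
by apply: cvgB; [exact: cvg_cst|exact: cvg_id].
Qed.

Lemma bounded_ball (R : realType) (V : normedModType R) (A : set V) (a : V) (r : R) :
  (forall y, A y -> `|y - a| <= r) -> bounded_set A.
Proof.
move=> Ar; exists (`|a| + r); split; first exact: num_real.
move=> M rM y /Ar yr /=; rewrite -[y](subrK a).
by rewrite (le_trans (ler_normD _ _)) // (le_trans _ (ltW rM)) // [leRHS]addrC lerD2r.
Qed.

(* The distance to [K] has right upper derivative at most [L] times itself:
   compare [x] with a curve in [K] that leaves a nearest point with the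
   velocity prescribed by [F]. *)
Lemma nagumo (R : realType) (n : nat) (K : set 'rV[R]_n) (x0 : 'rV[R]_n)
    (r L T : R) (F : 'rV[R]_n -> 'rV[R]_n) (x : R -> 'rV[R]_n) :
  0 < r -> 0 <= L ->
  closed [set y | K y /\ `|y - x0| <= r] ->
  (forall y z, `|y - x0| <= r -> `|z - x0| <= r -> `|F y - F z| <= L * `|y - z|) ->
  (forall y, K y -> `|y - x0| < r -> exists k : R -> 'rV[R]_n,
     [/\ k 0 = y, is_derive (0 : R) 1 k (F y) & \forall h \near 0^'+, K (k h)]) ->
  K x0 -> x 0 = x0 ->
  (forall t, 0 <= t <= T -> {for t, continuous x} /\ `|x t - x0| <= r / 3) ->
  (forall t : R, 0 < t < T -> is_derive t 1 x (F (x t))) ->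
  forall t, 0 <= t <= T -> K (x t).
Proof.
move=> r0 L0 Kcl FL Ktan Kx0 xx0 xr dx.
pose KB := [set y | K y /\ `|y - x0| <= r].
have KBx0 : KB x0 by split => //; rewrite subrr normr0 ltW.
have KBc : compact KB.
  by apply: bounded_closed_compact => //; apply: (@bounded_ball _ _ _ x0 r) => y [].
have /choice[p pP] y : exists p, KB p /\ forall q, KB q -> `|y - p| <= `|y - q|.
  have [||p /set_mem KBp pmin] := @EVT_min_rV R n (fun q => `|y - q|) KB _ KBc.
  - by exists x0.
  - by apply: continuous_subspaceT => q; exact: norm_sub_continuous.
  by exists p; split => // q KBq; apply: pmin; rewrite inE.
pose E t := `|x t - p (x t)|.
have Elip s t : E s <= E t + `|x s - x t|.
  have /le_trans := (pP (x s)).2 _ (pP (x t)).1; apply.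
  by rewrite /E [leRHS]addrC ler_distD.
have cE t : 0 <= t <= T -> {for t, continuous E}.
  move=> /xr[/cvgrPdist_le cx _]; apply/cvgrPdist_le => e e0.
  apply: filterS (cx e e0) => s ts; have := Elip s t; have := Elip t s.
  by rewrite distrC in ts; rewrite [`|x t - x s|]distrC ler_norml => *; apply/andP; split; lra.
(* Because [x0] itself belongs to [KB], the nearest point is within [r / 3] of [x t], hence within
   [2r / 3] of [x0]. Being strictly inside the ball, it has a tangent curve that stays in [KB] for a
   short time. *)
have pr t : 0 <= t <= T -> `|p (x t) - x0| < r.
  move=> /xr[_ xt]; rewrite (le_lt_trans (ler_distD (x t) _ _)) //.
  rewrite distrC (le_lt_trans (lerD ((pP (x t)).2 _ KBx0) (lexx _))) //.
  by rewrite (le_lt_trans (lerD xt xt)) //; lra.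
suff E0 t : 0 <= t <= T -> E t <= 0.
  move=> t /E0; rewrite normr_le0 subr_eq0 => /eqP ->.
  by case: (pP (x t)) => -[].
move=> tT; have -> : 0 = (0 + 0) * expR ((L + 1) * t) by rewrite addr0 mul0r.
apply: (@gronwall R E L 0 0 T) => //.
  have := (pP (x 0)).2 _ KBx0; rewrite -/(E 0) => /le_trans; apply.
  by rewrite xx0 subrr normr0.
move=> {tT}t tT e e0; have tT' : 0 <= t <= T by case/andP: tT => /ltW-> /ltW->.
have [[Kp _] _] := pP (x t).
have [k [k0 dk Kk]] := Ktan _ Kp (pr _ tT').
have e2 : 0 < e / 2 by rewrite divr_gt0.
have /is_derive1_dist /(_ _ e2) Hx := dx t tT.
have Hk := dk; move/is_derive1_dist : Hk => /(_ _ e2) Hk.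
have ck : \forall h \near (0 : R), `|k h - x0| < r.
  have /cvgrPdist_lt := is_derive1_continuous dk.
  move=> /(_ (r - `|p (x t) - x0|)); rewrite subr_gt0 pr // => /(_ isT).
  apply: filterS => h; rewrite k0 distrC ltrBrDr => kh.
  by rewrite (le_lt_trans (ler_distD (p (x t)) _ _)).
near=> h.
have h0 : 0 < h by near: h; exact: nbhs_right_gt.
have KBk : KB (k h).
  split; near: h => //.
  rewrite near_withinE; apply: filterS ck => h hr _; exact: ltW.
have := (pP (x (t + h))).2 _ KBk; rewrite -/(E _) => /le_trans; apply.
have Hx' : `|x (t + h) - x t - h *: F (x t)| <= e / 2 * h.
  rewrite -[X in _ * X](ger0_norm (ltW h0)); near: h.
  by rewrite near_withinE; apply: filterS Hx.
have Hk' : `|k h - p (x t) - h *: F (p (x t))| <= e / 2 * h.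
  rewrite -[X in _ * X](ger0_norm (ltW h0)); near: h.
  by rewrite near_withinE; apply: filterS Hk => h; rewrite add0r k0.
have FE : `|h *: (F (x t) - F (p (x t)))| <= h * (L * E t).
  rewrite normrZ (ger0_norm (ltW h0)) ler_pM2l // FL ?ltW ?pr //.
  by have := (xr t tT').2; lra.
(* Each curve departs from its linear prediction by at most [e / 2 * h]; the remaining terms are the
   present distance and the difference of velocities, at most [L * E t]. *)
have -> : x (t + h) - k h = (x (t + h) - x t - h *: F (x t)) -
    (k h - p (x t) - h *: F (p (x t))) + (x t - p (x t)) + h *: (F (x t) - F (p (x t))).
  rewrite scalerBr.
  move: (x (t + h)) (x t) (k h) (p (x t)) (h *: _) (h *: _) => a b c d u v.
  by apply/rowP => i; rewrite !mxE; ring.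
rewrite (le_trans (ler_normD _ _)) //.
rewrite (le_trans (lerD (ler_normD _ _) (lexx _))) //.
rewrite (le_trans (lerD (lerD (ler_normB _ _) (lexx _)) (lexx _))) // -/(E t).
by lra.
Unshelve. all: by end_near. Qed.

Fixpoint euler (R : realType) (V : lmodType R) (F : V -> V) (x0 : V) (h : R)
    (k : nat) : V :=
  if k is k'.+1 then euler F x0 h k' + h *: F (euler F x0 h k') else x0.

(** An ultrafilter stands in for the extraction of subsequences: along one fixed ultrafilter the
    Euler approximations converge at all times simultaneously, so no diagonal or Arzela-Ascoli
    argument is needed. *)
Lemma ultra_compact_cvg (T : topologicalType) (A : set T) (D : set_system nat)
    (u : nat -> T) :
  UltraFilter D -> compact A -> (forall N, A (u N)) ->
  exists2 l, A l & u @ D --> l.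
Proof.
move=> DU cA Au.
have [|l [Al cl]] := cA (u @ D) _.
  by rewrite nbhs_simpl /=; apply: filterS filterT => N _; exact: Au.
exists l => // B Bl; rewrite /=.
have [//|DC] := in_ultra_setVsetC (u @^-1` B) DU.
by have [y []] := cl (~` B) B DC Bl.
Qed.

Section EulerScheme.
Variables (R : realType) (n : nat) (F : 'rV[R]_n -> 'rV[R]_n) (x0 : 'rV[R]_n).
Variables (r L M : R).
Hypotheses (L0 : 0 <= L) (M0 : 0 < M).
Hypothesis FL : forall y z, `|y - x0| <= r -> `|z - x0| <= r ->
  `|F y - F z| <= L * `|y - z|.
Hypothesis FM : forall y, `|y - x0| <= r -> `|F y| <= M.

Lemma euler_ball h k : 0 <= h -> k%:R * h * M <= r ->
  `|euler F x0 h k - x0| <= k%:R * h * M.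
Proof.
move=> h0; elim: k => [|k IH] kr; first by rewrite /= subrr normr0 !mul0r.
have kS : k.+1%:R * h * M = k%:R * h * M + h * M by rewrite -[k.+1]addn1 natrD; ring.
have hM : 0 <= h * M by rewrite mulr_ge0 // ltW.
have kr' : k%:R * h * M <= r by lra.
have Fk := FM (le_trans (IH kr') kr').
rewrite /= kS addrAC (le_trans (ler_normD _ _)) // lerD ?IH //.
by rewrite normrZ ger0_norm // ler_wpM2l.
Qed.

Lemma euler_lipschitz h j d : 0 <= h -> (j + d)%:R * h * M <= r ->
  `|euler F x0 h (j + d) - euler F x0 h j| <= d%:R * h * M.
Proof.
move=> h0; elim: d => [|d IH] kr; first by rewrite addn0 subrr normr0 !mul0r.
have kS k : k.+1%:R * h * M = k%:R * h * M + h * M by rewrite -[k.+1]addn1 natrD; ring.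
have hM : 0 <= h * M by rewrite mulr_ge0 // ltW.
rewrite addnS kS in kr.
have kr' : (j + d)%:R * h * M <= r by lra.
rewrite addnS kS /= addrAC (le_trans (ler_normD _ _)) // lerD ?IH //.
rewrite normrZ ger0_norm // ler_wpM2l // FM //.
by rewrite (le_trans (euler_ball _ kr')).
Qed.

(** Over [d] steps the polygon moves by at most [d * h * M], so [F] drifts by at most [L] times
    that, and the drifts add up to a quadratic error. The bound depends on [d] and [h] only through
    the elapsed time [d * h], which lets it survive the limit. *)
Lemma euler_consistent h j d : 0 <= h -> (j + d)%:R * h * M <= r ->
  `|euler F x0 h (j + d) - euler F x0 h j - (d%:R * h) *: F (euler F x0 h j)|
    <= L * M * (d%:R * h) ^+ 2.
Proof.
move=> h0; elim: d => [|d IH] kr.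
  by rewrite addn0 subrr mul0r scale0r subrr normr0 expr0n mulr0.
have hM : 0 <= h * M by rewrite mulr_ge0 // ltW.
have kr' : (j + d)%:R * h * M <= r.
  by move: kr; rewrite addnS -[(j + d).+1]addn1 natrD; lra.
have jr : j%:R * h * M <= r.
  by apply: le_trans kr'; rewrite -!mulrA ler_wpM2r // ler_nat leq_addr.
rewrite addnS /= -[d.+1]addn1 natrD.
have -> : (d%:R + 1) * h = d%:R * h + h by ring.
set y := euler F x0 h; pose A := y (j + d)%N - y j - (d%:R * h) *: F (y j).
rewrite (_ : _ - _ = A + h *: (F (y (j + d)%N) - F (y j))); last first.
  by apply/rowP => i; rewrite !mxE; ring.
rewrite (le_trans (ler_normD _ _)) // (le_trans (lerD (IH kr') (lexx _))) //.
have FF : `|h *: (F (y (j + d)%N) - F (y j))| <= h * (L * (d%:R * h * M)).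
  rewrite normrZ ger0_norm // ler_wpM2l //.
  have /le_trans := FL (le_trans (euler_ball h0 kr') kr') (le_trans (euler_ball h0 jr) jr).
  by apply; rewrite ler_wpM2l // euler_lipschitz.
rewrite (le_trans (lerD (lexx _) FF)) //.
have LM0 : 0 <= L * M by rewrite mulr_ge0 // ltW.
have -> : L * M * (d%:R * h + h) ^+ 2 = L * M * (d%:R * h) ^+ 2 + h * (L * (d%:R * h * M))
   + L * M * (d%:R * h ^+ 2 + h ^+ 2) by ring.
by rewrite lerDl mulr_ge0 // addr_ge0 ?mulr_ge0 ?sqr_ge0.
Qed.

(** The quadratic estimate is kept instead of an integral equation: it already contains
    differentiability of the limit and the equation it solves. *)
Lemma euler_limit : exists x : R -> 'rV[R]_n,
  (forall t, 0 <= t <= r / M -> `|x t - x0| <= r) /\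
  (forall s t, 0 <= s -> s <= t -> t <= r / M ->
     `|x t - x s - (t - s) *: F (x s)| <= L * M * (t - s) ^+ 2).
Proof.
pose h N : R := harmonic N.
have h0 N : 0 < h N by rewrite /h /harmonic /= invr_gt0 ltr0n.
pose k t N := Num.truncn (t / h N).
have kP t N : 0 <= t -> (k t N)%:R * h N <= t < (k t N)%:R * h N + h N.
  move=> t0; have /truncn_itv/andP[] : 0 <= t / h N by rewrite divr_ge0 // ltW.
  rewrite ler_pdivlMr // ltr_pdivrMr // -/(k t N) => -> /=.
  by rewrite -[_.+1]addn1 natrD mulrDl mul1r.
pose u t N := euler F x0 (h N) (k t N).
have kr t N : 0 <= t -> t <= r / M -> (k t N)%:R * h N * M <= r.
  move=> t0; rewrite ler_pdivlMr // => /(le_trans _); apply.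
  by rewrite ler_wpM2r ?(ltW M0) //; case/andP: (kP t N t0).
have uB t N : 0 <= t -> t <= r / M -> `|u t N - x0| <= r.
  by move=> t0 tr; rewrite (le_trans (euler_ball (ltW (h0 N)) (kr t N t0 tr))) // kr.
have [D [DU DF]] := ultraFilterLemma (eventually_filter).
pose B := [set y | `|y - x0| <= r].
have Bcl : closed B.
  have -> : B = closed_ball_ Num.norm x0 r.
    by apply/seteqP; split => y; rewrite /B /closed_ball_ /= distrC.
  exact: closed_closed_ball_.
have Bc : compact B by apply: bounded_closed_compact => //; exact: (@bounded_ball _ _ _ x0 r).
have /choice[x xP] t : exists l, 0 <= t <= r / M -> B l /\ u t @ D --> l.
  have [/andP[t0 tr]|] := boolP (0 <= t <= r / M); last by exists 0.
  by have [l Bl ul] := ultra_compact_cvg DU Bc (fun N => uB t N t0 tr); exists l.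
exists x; split => [t /xP[]//|s t s0 st tr].
have t0 := le_trans s0 st; have sr := le_trans st tr.
have [Bs us] : B (x s) /\ u s @ D --> x s by apply: xP; rewrite s0.
have [Bt ut] : B (x t) /\ u t @ D --> x t by apply: xP; rewrite t0.
have hD : h @ D --> (0 : R) by move=> A hA; apply: DF; exact: (cvg_harmonic hA).
have Fs : F (u s N) @[N --> D] --> F (x s).
  apply/cvgrPdist_le => e e0; have e1 : 0 < e / (1 + L) by rewrite divr_gt0 // ltr_pwDl.
  move/cvgrPdist_le : us => /(_ _ e1); apply: filterS => N H.
  rewrite (le_trans (FL _ (uB _ _ _ _))) //.
  rewrite (le_trans (ler_wpM2l L0 H)) // mulrCA ler_piMr ?(ltW e0) //.
  by rewrite ler_pdivrMr ?ltr_pwDl // mul1r lerDr.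
have lhs : `|u t N - u s N - (t - s) *: F (u s N)| @[N --> D] -->
    `|x t - x s - (t - s) *: F (x s)|.
  by apply: cvg_norm; apply: cvgB; [exact: cvgB|exact: cvgZl_tmp].
(* Rounding [s] and [t] down to the grid changes the elapsed time by at most [h N]. This produces
   both the enlarged square and the extra term [h N * M], which vanish in the limit. *)
have rhs : L * M * (t - s + h N) ^+ 2 + h N * M @[N --> D] -->
    L * M * (t - s + 0) ^+ 2 + 0 * M.
  apply: cvgD; last exact: cvgMr_tmp.
  apply: cvgMl_tmp; apply: (@cvg_comp _ _ _ (fun N => t - s + h N) (fun y => y ^+ 2)).
    by apply: cvgD; [exact: cvg_cst|exact: hD].
  exact: exprn_continuous.
rewrite addr0 mul0r addr0 in rhs.
apply: (ler_cvg_to lhs rhs); apply: filterS (filterT : D setT) => N _.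
have ks : (k s N <= k t N)%N by apply: le_truncn; rewrite ler_pM2r ?invr_gt0.
have /andP[s1 s2] := kP s N s0; have /andP[t1 t2] := kP t N t0.
pose d := (k t N - k s N)%N.
have ktE : k t N = (k s N + d)%N by rewrite subnKC.
have dh : d%:R * h N = (k t N)%:R * h N - (k s N)%:R * h N.
  by rewrite -mulrBl natrB.
have := @euler_consistent (h N) (k s N) d (ltW (h0 N)).
rewrite -ktE => /(_ (kr t N t0 tr)); rewrite -/(u t N) -/(u s N) => H.
rewrite (_ : _ - _ - _ = (u t N - u s N - (d%:R * h N) *: F (u s N)) +
  (d%:R * h N - (t - s)) *: F (u s N)); last by apply/rowP => i; rewrite !mxE; ring.
rewrite (le_trans (ler_normD _ _)) // lerD //.
  rewrite (le_trans H) // ler_wpM2l ?mulr_ge0 ?(ltW M0) //.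
  have e0 : 0 <= t - s + h N by have := h0 N; lra.
  by rewrite ler_pXn2r ?nnegrE ?mulr_ge0 ?(ltW (h0 N)) // dh; lra.
rewrite normrZ ler_pM ?FM ?uB // ler_norml dh; apply/andP; split; lra.
Qed.

End EulerScheme.

(** Only an open forward interval is claimed. This suffices on a group, where an inner point of the
    curve can later be translated to 1. *)
Lemma ode_local_existence (R : realType) (n : nat) (F : 'rV[R]_n -> 'rV[R]_n)
    (x0 : 'rV[R]_n) (r L : R) :
  0 < r -> 0 <= L ->
  (forall y z, `|y - x0| <= r -> `|z - x0| <= r -> `|F y - F z| <= L * `|y - z|) ->
  exists T (x : R -> 'rV[R]_n), 0 < T /\ forall t, 0 < t < T ->
    `|x t - x0| <= r /\ is_derive t 1 x (F (x t)).
Proof.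
move=> r0 L0 FL; pose M := `|F x0| + L * r + 1.
have M0 : 0 < M by rewrite /M ltr_wpDl // addr_ge0 // mulr_ge0 // ltW.
have FM y : `|y - x0| <= r -> `|F y| <= M.
  move=> yr; have x0r : `|x0 - x0| <= r by rewrite subrr normr0 ltW.
  have := FL y x0 yr x0r; have := ler_wpM2l L0 yr => H1 H2.
  rewrite -[F y](subrK (F x0)) (le_trans (ler_normD _ _)) // /M; lra.
have [x [xB xP]] := euler_limit L0 M0 FL FM.
exists (r / M), x; split=> [|t /andP[t0 tT]]; first exact: divr_gt0.
have tB : `|x t - x0| <= r by apply: xB; rewrite !ltW.
split=> //; apply/is_derive1_dist => e e0.
(* For negative [h] the Euler estimate is based at [t + h]. The second summand is the cost of
   replacing [F (x (t + h))] by [F (x t)], through the Lipschitz bound and the size of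
   [x (t + h) - x t]. *)
pose C := L * M + L * (M + L * M * (r / M)).
have LM0 : 0 <= L * M by rewrite mulr_ge0 // ltW.
have rM0 : 0 <= r / M by rewrite divr_ge0 // ltW.
have C0 : 0 <= C by rewrite addr_ge0 // mulr_ge0 // addr_ge0 ?(ltW M0) // mulr_ge0.
have est h : 0 <= t + h <= r / M -> `|x (t + h) - x t - h *: F (x t)| <= C * `|h| ^+ 2.
  move=> /andP[th0 thT]; have [h0|/ltW h0] := lerP 0 h.
    have tth : t <= t + h by rewrite lerDl.
    have := xP t (t + h) (ltW t0) tth thT.
    have -> : t + h - t = h by ring.
    move=> /le_trans; apply; rewrite (ger0_norm h0) ler_wpM2r ?sqr_ge0 //.
    by rewrite lerDl mulr_ge0 // addr_ge0 ?(ltW M0) // mulr_ge0.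
  have tth : t + h <= t by rewrite gerDl.
  have := xP (t + h) t th0 tth (ltW tT).
  have -> : t - (t + h) = - h by ring.
  rewrite sqrrN scaleNr opprK -[h ^+ 2]real_normK ?num_real // => A.
  have hr : `|h| <= r / M by rewrite ler0_norm //; lra.
  have thB : `|x (t + h) - x0| <= r by apply: xB; rewrite th0.
  pose a := x t - x (t + h) + h *: F (x (t + h)).
  have xx : `|x (t + h) - x t| <= `|h| * (M + L * M * (r / M)).
    rewrite (_ : _ - _ = h *: F (x (t + h)) - a); last first.
      by apply/rowP => i; rewrite !mxE; ring.
    rewrite (le_trans (ler_normB _ _)) // mulrDr normrZ lerD ?ler_wpM2l ?FM //.
    by rewrite (le_trans A) // expr2 mulrCA ler_wpM2l // ler_wpM2l.
  rewrite (_ : _ - _ - _ = h *: (F (x (t + h)) - F (x t)) - a); last first.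
    by apply/rowP => i; rewrite !mxE; ring.
  rewrite (le_trans (ler_normB _ _)) // /C mulrDl addrC lerD // normrZ.
  rewrite [leRHS](_ : _ = `|h| * (L * (`|h| * (M + L * M * (r / M))))); last by ring.
  by rewrite ler_wpM2l // (le_trans (FL _ _ thB tB)) // ler_wpM2l.
have C1 : 0 < 1 + C by rewrite ltr_pwDl.
apply/nbhs_ballP; exists (Num.min (e / (1 + C)) (Num.min t (r / M - t))) => [|h] /=.
  by rewrite !lt_min divr_gt0 // t0 subr_gt0 tT.
rewrite /ball /= sub0r normrN !lt_min => /and3P[he ht hT].
have hh := ler_norm h; have hh' := ler_norm (- h); rewrite normrN in hh'.
have thI : 0 <= t + h <= r / M by apply/andP; split; lra.
rewrite (le_trans (est h thI)) // expr2 mulrA ler_wpM2r //.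
rewrite ltr_pdivlMr // in he; apply: le_trans (ltW he).
by rewrite mulrC ler_wpM2l // lerDr.
Qed.

(** * Velocities on manifolds *)

Lemma chart_imP (R : realType) (n : nat) (M : topologicalType) (c : chart R n M) x :
  chart_im c x -> chart_dom c (chart_inv c x) /\ c (chart_inv c x) = x.
Proof. by move=> [p cp <-]; rewrite chart_mapK. Qed.

Lemma chart_im_map (R : realType) (n : nat) (M : topologicalType) (c : chart R n M) p :
  chart_dom c p -> chart_im c (c p).
Proof. by move=> cp; exists p. Qed.

Lemma chart_inv_nbhs (R : realType) (n : nat) (M : topologicalType)
    (c : chart R n M) (A : set M) x :
  chart_im c x -> nbhs (chart_inv c x) A ->
  \forall y \near x, chart_im c y /\ A (chart_inv c y).
Proof.
move=> cx Ax; apply: filterI.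
  by apply: open_nbhs_nbhs; split => //; exact: chart_im_open.
exact: (chart_inv_continuous cx).
Qed.

Lemma chart_image_open (R : realType) (n : nat) (M : topologicalType)
    (c : chart R n M) (A : set M) :
  open A -> open (c @` (chart_dom c `&` A)).
Proof.
move=> oA; rewrite openE => _ [p [cp Ap] <-].
have := @chart_inv_nbhs _ _ _ c A (c p) (chart_im_map cp) _.
rewrite chart_mapK // => /(_ (open_nbhs_nbhs (conj oA Ap))).
apply: filterS => y [/chart_imP[cy cyE] Ay].
by exists (chart_inv c y).
Qed.

Lemma chart_dom_near (R : realType) (n : nat) (M : topologicalType)
    (c : chart R n M) (T : topologicalType) (g : T -> M) (t : T) :
  {for t, continuous g} -> chart_dom c (g t) -> \forall s \near t, chart_dom c (g s).
Proof.
by move=> cg cgt; apply: cg; exact: (open_nbhs_nbhs (conj (chart_dom_open c) cgt)).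
Qed.

Lemma transition_differentiable (R : realType) (n : nat) (M : manifoldType R n)
    (c d : chart R n M) p :
  atlas c -> atlas d -> chart_dom c p -> chart_dom d p ->
  differentiable (d \o chart_inv c) (c p).
Proof.
move=> ac ad cp dp.
apply: (@C1_differentiable _ _ _ (c @` (chart_dom c `&` chart_dom d))).
- exact: chart_image_open (chart_dom_open d).
- by exists p.
- exact: atlas_compatible.
Qed.

Lemma transition_velocity (R : realType) (n : nat) (M : manifoldType R n)
    (c d : chart R n M) (g : R -> M) (t : R) (v : 'rV[R]_n) :
  atlas c -> atlas d -> chart_dom c (g t) -> chart_dom d (g t) ->
  {for t, continuous g} -> is_derive t 1 (c \o g) v ->
  is_derive t 1 (d \o g) ('d (d \o chart_inv c) (c (g t)) v).
Proof.
move=> ac ad cp dp cg cv.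
have := is_derive1_comp_diff cv (transition_differentiable ac ad cp dp).
apply: near_eq_is_derive; apply: filterS (chart_dom_near cg cp) => s cs /=.
by rewrite chart_mapK.
Qed.

(** A straight line in the chart. Realizing every vector as a velocity is what lets later identities
    between differentials be read off from curves. *)
Lemma chart_curve (R : realType) (n : nat) (M : topologicalType)
    (c : chart R n M) p (v : 'rV[R]_n) : chart_dom c p ->
  exists g : R -> M, [/\ g 0 = p, {for (0 : R), continuous g} &
    is_derive (0 : R) 1 (c \o g) v].
Proof.
move=> cp; pose l (s : R) := s *: v + c p.
have dl : is_derive (0 : R) 1 l v by exact: is_derive1_line.
have cl := is_derive1_continuous dl.
have l0 : l 0 = c p by rewrite /l scale0r add0r.
have lc : chart_im c (l 0) by rewrite l0; exact: chart_im_map.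
exists (chart_inv c \o l); split.
- by rewrite /= l0 chart_mapK.
- by apply: continuous_comp => //; exact: chart_inv_continuous.
apply: near_eq_is_derive dl.
have : \forall s \near (0 : R), chart_im c (l s).
  by apply: cl; apply: open_nbhs_nbhs; split => //; exact: chart_im_open.
by apply: filterS => s /chart_imP[_ /=].
Qed.

Lemma is_derive1_unique (R : realType) (W : normedModType R) (f : R -> W)
    (t : R) (v w : W) :
  is_derive t 1 f v -> is_derive t 1 f w -> v = w.
Proof. by move=> [_ <-] [_ <-]. Qed.

(** A curve with velocity [v] is read in [c], then in [d], then in [c] again; uniqueness of the
    derivative gives the identity. *)
Lemma transitionK (R : realType) (n : nat) (M : manifoldType R n)
    (c d : chart R n M) p (v : 'rV[R]_n) :
  atlas c -> atlas d -> chart_dom c p -> chart_dom d p ->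
  'd (c \o chart_inv d) (d p) ('d (d \o chart_inv c) (c p) v) = v.
Proof.
move=> ac ad cp dp; have [g [g0 cg cv]] := chart_curve v cp.
have cg0 : chart_dom c (g 0) by rewrite g0.
have dg0 : chart_dom d (g 0) by rewrite g0.
have := transition_velocity ad ac dg0 cg0 cg (transition_velocity ac ad cg0 dg0 cg cv).
by rewrite g0 => /is_derive1_unique; apply.
Qed.

Lemma has_velocity_chart (R : realType) (n : nat) (M : manifoldType R n)
    (c : chart R n M) (g : R -> M) (t : R) (v : 'rV[R]_n) :
  atlas c -> chart_dom c (g t) -> has_velocity g t v ->
  is_derive t 1 (c \o g)
    ('d (c \o chart_inv (chart_at (g t))) (chart_at (g t) (g t)) v).
Proof.
move=> ac cg [cont dg]; apply: transition_velocity => //.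
- exact: chart_at_atlas.
- exact: chart_at_dom.
Qed.

Lemma chart_has_velocity (R : realType) (n : nat) (M : manifoldType R n)
    (c : chart R n M) (g : R -> M) (t : R) (v : 'rV[R]_n) :
  atlas c -> chart_dom c (g t) -> {for t, continuous g} ->
  is_derive t 1 (c \o g)
    ('d (c \o chart_inv (chart_at (g t))) (chart_at (g t) (g t)) v) ->
  has_velocity g t v.
Proof.
move=> ac cg cont dg; split=> //.
have ap := chart_at_atlas (g t); have dp := chart_at_dom (g t).
by have := transition_velocity ac ap cg dp cont dg; rewrite transitionK.
Qed.

Lemma has_velocity_rep (R : realType) (n : nat) (M : manifoldType R n)
    (X : M -> 'rV[R]_n) (c : chart R n M) (g : R -> M) (t : R) :
  atlas c -> chart_dom c (g t) -> has_velocity g t (X (g t)) ->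
  is_derive t 1 (c \o g) (vf_rep X c (c (g t))).
Proof. by move=> ac cg /(has_velocity_chart ac cg); rewrite /vf_rep chart_mapK. Qed.

Lemma rep_has_velocity (R : realType) (n : nat) (M : manifoldType R n)
    (X : M -> 'rV[R]_n) (c : chart R n M) (g : R -> M) (t : R) :
  atlas c -> chart_dom c (g t) -> {for t, continuous g} ->
  is_derive t 1 (c \o g) (vf_rep X c (c (g t))) -> has_velocity g t (X (g t)).
Proof.
move=> ac cg cont dg; apply: (chart_has_velocity ac cg cont).
by move: dg; rewrite /vf_rep chart_mapK.
Qed.

Lemma has_velocity_unique (R : realType) (n : nat) (M : manifoldType R n)
    (g : R -> M) (t : R) (v w : 'rV[R]_n) :
  has_velocity g t v -> has_velocity g t w -> v = w.
Proof. by move=> [_ gv] [_ gw]; exact: is_derive1_unique gv gw. Qed.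

Lemma velocity_curve (R : realType) (n : nat) (M : manifoldType R n)
    (p : M) (v : 'rV[R]_n) :
  exists g : R -> M, g 0 = p /\ has_velocity g 0 v.
Proof.
have [g [g0 cg dg]] := chart_curve v (chart_at_dom p).
by exists g; split=> //; split=> //; rewrite g0.
Qed.

(** The pointwise hypothesis that the chain rule for curves needs. It can be checked for
    translations in the preferred charts alone, without establishing [smooth_map]. *)
Definition manifold_differentiable (R : realType) (n1 n2 : nat)
    (M : manifoldType R n1) (N : manifoldType R n2) (F : M -> N) (p : M) : Prop :=
  {for p, continuous F} /\
  differentiable (chart_at (F p) \o F \o chart_inv (chart_at p)) (chart_at p p).

Lemma smooth_map_differentiable (R : realType) (n1 n2 : nat)
    (M : manifoldType R n1) (N : manifoldType R n2) (F : M -> N) (p : M) :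
  smooth_map F -> manifold_differentiable F p.
Proof.
move=> [cF sF]; split; first exact: cF.
have ap := chart_at_atlas p; have aF := chart_at_atlas (F p).
apply: (@C1_differentiable _ _ _ (chart_at p @` (chart_dom (chart_at p) `&`
  F @^-1` chart_dom (chart_at (F p))))).
- apply: chart_image_open; apply: open_comp => [x _|]; first exact: cF.
  exact: chart_dom_open.
- by exists p => //; split; exact: chart_at_dom.
- exact: sF.
Qed.

Lemma has_velocity_comp (R : realType) (n1 n2 : nat)
    (M : manifoldType R n1) (N : manifoldType R n2) (F : M -> N)
    (g : R -> M) (t : R) (v : 'rV[R]_n1) :
  manifold_differentiable F (g t) -> has_velocity g t v ->
  has_velocity (F \o g) t (tangent_map F (g t) v).
Proof.
move=> [cF dF] [cg dg]; split; first exact: continuous_comp.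
have := is_derive1_comp_diff dg dF; apply: near_eq_is_derive.
apply: filterS (chart_dom_near cg (chart_at_dom (g t))) => s cs /=.
by rewrite chart_mapK.
Qed.

(** * Right-invariant vector fields on Lie groups *)

Lemma Ck_subset (R : realType) (V W : normedModType R) k (U U' : set V)
    (f : V -> W) : U' `<=` U -> Ck k U f -> Ck k U' f.
Proof.
move=> UU'; elim: k f => [|k IH] f [cf df]; split=> //.
- by move=> x /UU'; exact: cf.
- by move=> x /UU'; exact: cf.
by move=> v; have [der /IH] := df v; split=> // x /UU'; exact: der.
Qed.

Lemma continuous_pair (T U V : topologicalType) (f : T -> U) (g : T -> V) (x : T) :
  {for x, continuous f} -> {for x, continuous g} ->
  {for x, continuous (fun y => (f y, g y))}.
Proof. by move=> cf cg; apply: cvg_pair. Qed.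

Lemma row_mx_norm_le (R : realType) (n1 n2 : nat) (x : 'rV[R]_n1) (y : 'rV[R]_n2) (M : R) :
  `|x| <= M -> `|y| <= M -> `|row_mx x y| <= M.
Proof.
move=> xM yM; apply: rV_norm_le => [|i]; first exact: le_trans xM.
rewrite mxE; case: (fintype.split i) => j.
- by rewrite (le_trans (rV_coord_le _ _)).
- by rewrite (le_trans (rV_coord_le _ _)).
Qed.

Lemma row_mxl_continuous (R : realType) (n1 n2 : nat) (y : 'rV[R]_n2) :
  continuous (fun x : 'rV[R]_n1 => row_mx x y).
Proof.
move=> x A /nbhs_ballP[e /= e0 eA]; apply/nbhs_ballP; exists e => //= z.
rewrite -ball_normE /= => ze; apply: eA.
rewrite -ball_normE /= opp_row_mx add_row_mx subrr; apply: le_lt_trans ze.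
by apply: row_mx_norm_le; rewrite ?normr0.
Qed.

Lemma row_mxr_continuous (R : realType) (n1 n2 : nat) (x : 'rV[R]_n1) :
  continuous (fun y : 'rV[R]_n2 => row_mx x y).
Proof.
move=> y A /nbhs_ballP[e /= e0 eA]; apply/nbhs_ballP; exists e => //= z.
rewrite -ball_normE /= => ze; apply: eA.
rewrite -ball_normE /= opp_row_mx add_row_mx subrr; apply: le_lt_trans ze.
by apply: row_mx_norm_le; rewrite ?normr0.
Qed.

Lemma is_derive1_row_mx (R : realType) (n1 n2 : nat) (f : R -> 'rV[R]_n1)
    (g : R -> 'rV[R]_n2) (t : R) v w :
  is_derive t 1 f v -> is_derive t 1 g w ->
  is_derive t 1 (fun s => row_mx (f s) (g s)) (row_mx v w).
Proof.
move=> /is_derive1_dist df /is_derive1_dist dg; apply/is_derive1_dist => e e0.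
apply: filterS2 (df e e0) (dg e e0) => h fh gh.
rewrite scale_row_mx !opp_row_mx !add_row_mx; exact: row_mx_norm_le.
Qed.

(* Multiplication of [G] in charts, on R^(n+n) rather than on R^n x R^n so that
   [C1_differentiable] applies. *)
Definition chart_mul (R : realType) (n : nat) (G : lieGroupType R n)
    (a b c : chart R n G) (z : 'rV[R]_(n + n)) : 'rV[R]_n :=
  c (chart_inv a (lsubmx z) * chart_inv b (rsubmx z))%g.

Definition chart_mul_dom (R : realType) (n : nat) (G : lieGroupType R n)
    (a b c : chart R n G) : set 'rV[R]_(n + n) :=
  [set z | [/\ chart_im a (lsubmx z), chart_im b (rsubmx z) &
     chart_dom c (chart_inv a (lsubmx z) * chart_inv b (rsubmx z))%g]].

Lemma lsubmx_rV_continuous (R : realType) (n1 n2 : nat) :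
  continuous (lsubmx : 'rV[R]_(n1 + n2) -> 'rV[R]_n1).
Proof. exact: (linear_rV_continuous (f := lsubmx)). Qed.

Lemma rsubmx_rV_continuous (R : realType) (n1 n2 : nat) :
  continuous (rsubmx : 'rV[R]_(n1 + n2) -> 'rV[R]_n2).
Proof. exact: (linear_rV_continuous (f := rsubmx)). Qed.

Lemma chart_mul_smooth (R : realType) (n : nat) (G : lieGroupType R n)
    (a b c : chart R n G) : atlas a -> atlas b -> atlas c ->
  smooth_on (chart_mul_dom a b c) (chart_mul a b c).
Proof.
move=> aa ab ac k.
pose i (z : 'rV[R]_(n + n)) : 'rV[R]_n * 'rV[R]_n := (lsubmx z, rsubmx z).
have := @Ck_affine R _ _ _ k _ _ i i _ _ (lie_mul_smooth a b c aa ab ac k); apply.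
- move=> z; apply: continuous_pair; [exact: lsubmx_rV_continuous|exact: rsubmx_rV_continuous].
- by move=> h v x; rewrite /i !linearP.
Qed.

Lemma chart_mul_dom_open (R : realType) (n : nat) (G : lieGroupType R n)
    (a b c : chart R n G) : open (chart_mul_dom a b c).
Proof.
rewrite openE => z [az bz cz].
pose m (z : 'rV[R]_(n + n)) := (chart_inv a (lsubmx z) * chart_inv b (rsubmx z))%g.
have cm : {for z, continuous m}.
  apply: (@continuous_comp _ _ _ (fun z => (chart_inv a (lsubmx z), chart_inv b (rsubmx z)))
    (fun y : G * G => (y.1 * y.2)%g)); last exact: lie_mul_continuous.
  apply: continuous_pair.
  - apply: (@continuous_comp _ _ _ lsubmx (chart_inv a)); first exact: lsubmx_rV_continuous.
    exact: chart_inv_continuous.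
  - apply: (@continuous_comp _ _ _ rsubmx (chart_inv b)); first exact: rsubmx_rV_continuous.
    exact: chart_inv_continuous.
have na : \forall y \near z, chart_im a (lsubmx y).
  by apply: lsubmx_rV_continuous; apply: open_nbhs_nbhs; split => //; exact: chart_im_open.
have nb : \forall y \near z, chart_im b (rsubmx y).
  by apply: rsubmx_rV_continuous; apply: open_nbhs_nbhs; split => //; exact: chart_im_open.
have nc := chart_dom_near cm cz.
by apply: filterS3 na nb nc => y; split.
Qed.

Lemma chart_mul_dom_map (R : realType) (n : nat) (G : lieGroupType R n)
    (a b c : chart R n G) p q :
  chart_dom a p -> chart_dom b q -> chart_dom c (p * q)%g ->
  chart_mul_dom a b c (row_mx (a p) (b q)).
Proof.
by move=> ap bq cpq; rewrite /chart_mul_dom /= row_mxKl row_mxKr !chart_mapK //;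
  split=> //; exact: chart_im_map.
Qed.

Lemma chart_mul_differentiable (R : realType) (n : nat) (G : lieGroupType R n)
    (a b c : chart R n G) p q :
  atlas a -> atlas b -> atlas c ->
  chart_dom a p -> chart_dom b q -> chart_dom c (p * q)%g ->
  differentiable (chart_mul a b c) (row_mx (a p) (b q)).
Proof.
move=> aa ab ac ap bq cpq.
apply: (@C1_differentiable _ _ _ (chart_mul_dom a b c)).
- exact: chart_mul_dom_open.
- exact: chart_mul_dom_map.
- exact: chart_mul_smooth.
Qed.

Lemma chart_mul_velocity (R : realType) (n : nat) (G : lieGroupType R n)
    (a b c : chart R n G) (g h : R -> G) (t : R) v w :
  atlas a -> atlas b -> atlas c ->
  chart_dom a (g t) -> chart_dom b (h t) -> chart_dom c (g t * h t)%g ->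
  {for t, continuous g} -> {for t, continuous h} ->
  is_derive t 1 (a \o g) v -> is_derive t 1 (b \o h) w ->
  is_derive t 1 (c \o (fun s => g s * h s)%g)
    ('d (chart_mul a b c) (row_mx (a (g t)) (b (h t))) (row_mx v w)).
Proof.
move=> aa ab ac ag bh cgh cg ch dg dh.
have := is_derive1_comp_diff (is_derive1_row_mx dg dh)
  (chart_mul_differentiable aa ab ac ag bh cgh).
apply: near_eq_is_derive.
apply: filterS2 (chart_dom_near cg ag) (chart_dom_near ch bh) => s gs hs.
by rewrite /chart_mul /= row_mxKl row_mxKr !chart_mapK.
Qed.

Lemma right_translation_differentiable (R : realType) (n : nat)
    (G : lieGroupType R n) (g p : G) :
  manifold_differentiable (fun q => q * g)%g p.
Proof.
split.
  apply: (@continuous_comp _ _ _ (fun q => (q, g)) (fun y : G * G => (y.1 * y.2)%g)).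
    by apply: continuous_pair; [exact: cvg_id|exact: cvg_cst].
  exact: lie_mul_continuous.
set a := chart_at p; set b := chart_at g; set c := chart_at (p * g)%g.
have aa : atlas a := chart_at_atlas p; have ab : atlas b := chart_at_atlas g.
have ac : atlas c := chart_at_atlas _.
have ap : chart_dom a p := chart_at_dom p; have bg : chart_dom b g := chart_at_dom g.
have cpg : chart_dom c (p * g)%g := chart_at_dom _.
pose i (x : 'rV[R]_n) : 'rV[R]_(n + n) := row_mx x (b g).
have -> : c \o (fun q => q * g)%g \o chart_inv a = chart_mul a b c \o i.
  by apply/funext => x; rewrite /chart_mul /= row_mxKl row_mxKr chart_mapK.
have ci : continuous i := @row_mxl_continuous _ _ _ _.
apply: (@C1_differentiable _ _ _ (i @^-1` chart_mul_dom a b c)).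
- apply: open_comp => [x _|]; [exact: ci|exact: chart_mul_dom_open].
- exact: chart_mul_dom_map.
- apply: (@Ck_affine _ _ _ _ _ _ _ i (fun v => row_mx v 0) ci) => [h v x|].
    by rewrite /i scale_row_mx add_row_mx scaler0 add0r.
  exact: chart_mul_smooth.
Qed.

(** The differential [m] of the multiplication is linear, so it splits over the two factors. Each
    part is identified by a curve along which the other factor is constant, and left multiplication
    by [g t = 1] leaves [w] unchanged. *)
Lemma has_velocity_mul (R : realType) (n : nat) (G : lieGroupType R n)
    (g h : R -> G) (t : R) (v w : 'rV[R]_n) :
  g t = 1%g -> has_velocity g t v -> has_velocity h t w ->
  has_velocity (fun s => g s * h s)%g t
    (tangent_map (fun q => q * h t)%g 1%g v + w).
Proof.
move=> g1 gv hw.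
pose a := chart_at (1%g : G); pose b := chart_at (h t).
have aa : atlas a := chart_at_atlas 1%g; have ab : atlas b := chart_at_atlas (h t).
have a1 : chart_dom a 1%g := chart_at_dom 1%g.
have bp : chart_dom b (h t) := chart_at_dom (h t).
pose m := 'd (chart_mul a b b) (row_mx (a 1%g) (b (h t))).
have mP (g' h' : R -> G) t' v' w' : g' t' = 1%g -> h' t' = h t ->
    has_velocity g' t' v' -> has_velocity h' t' w' ->
    is_derive t' 1 (b \o (fun s => g' s * h' s)%g) (m (row_mx v' w')).
  move=> g'1 h'h [cg' dg'] [ch' dh'].
  rewrite /m -g'1 -h'h; apply: chart_mul_velocity => //; rewrite ?g'1 ?h'h ?mul1g //.
  - by move: dg'; rewrite g'1.
  - by move: dh'; rewrite h'h.
have cst_v (p : G) : has_velocity (fun=> p) 0 (0 : 'rV[R]_n).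
  by split; [exact: cvg_cst|exact: is_derive_cst].
have E1 : m (row_mx v 0) = tangent_map (fun q => q * h t)%g 1%g v.
  have [k [k0 kv]] := velocity_curve (1%g : G) v.
  have H1 := mP k (fun=> h t) 0 v 0 k0 erefl kv (cst_v _).
  have kd : manifold_differentiable (fun q : G => q * h t)%g (k 0).
    exact: right_translation_differentiable.
  have [_] := has_velocity_comp kd kv.
  by rewrite /= k0 mul1g => H2; exact: is_derive1_unique H1 H2.
have E2 : m (row_mx 0 w) = w.
  have [k [k0 kv]] := velocity_curve (h t) w.
  have := mP (fun=> 1%g) k 0 0 w erefl k0 (cst_v _) kv.
  have -> : (fun s => 1 * k s)%g = k by apply/funext => s; rewrite mul1g.
  by case: kv => _; rewrite k0 => H1 H2; exact: is_derive1_unique H2 H1.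
split.
  case: gv hw => [cg _] [ch _].
  apply: (@continuous_comp _ _ _ (fun s => (g s, h s)) (fun y : G * G => (y.1 * y.2)%g)).
    exact: continuous_pair.
  exact: lie_mul_continuous.
have := mP g h t v w g1 erefl gv hw.
rewrite g1 mul1g -E1 -[X in _ + X]E2 -linearD add_row_mx addr0 add0r.
by [].
Qed.

Lemma has_velocity_right (R : realType) (n : nat) (G : lieGroupType R n)
    (g : R -> G) (t : R) (v : 'rV[R]_n) (q : G) :
  has_velocity g t v ->
  has_velocity (fun s => g s * q)%g t (tangent_map (fun q' => q' * q)%g (g t) v).
Proof.
by apply: has_velocity_comp; exact: right_translation_differentiable.
Qed.

Lemma integral_curve_right (R : realType) (n : nat) (G : lieGroupType R n)
    (Y : G -> 'rV[R]_n) (g : R -> G) (t : R) (q : G) :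
  right_invariant Y -> has_velocity g t (Y (g t)) ->
  has_velocity (fun s => g s * q)%g t (Y (g t * q)%g).
Proof. by move=> [_ Yinv] /has_velocity_right -/(_ q); rewrite Yinv. Qed.

(** The right-invariant extension of a tangent vector at 1: [right_field_invariant] shows that it is
    one, and [right_invariantE] that there is no other. *)
Definition right_field (R : realType) (n : nat) (G : lieGroupType R n)
    (v : 'rV[R]_n) (p : G) : 'rV[R]_n :=
  tangent_map (fun q : G => q * p)%g 1%g v.

Lemma right_field_velocity (R : realType) (n : nat) (G : lieGroupType R n)
    (g : R -> G) (v : 'rV[R]_n) (p : G) :
  g 0 = 1%g -> has_velocity g 0 v ->
  has_velocity (fun s => g s * p)%g 0 (right_field v p).
Proof. by move=> g0 /has_velocity_right -/(_ p); rewrite g0. Qed.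

Lemma right_invariantE (R : realType) (n : nat) (G : lieGroupType R n)
    (Y : G -> 'rV[R]_n) : right_invariant Y -> Y = right_field (Y 1%g).
Proof. by move=> [_ Yinv]; apply/funext => p; rewrite /right_field Yinv mul1g. Qed.

(** Associativity: [g s * (p * q)] and [g s * p * q] are the same curve, and its velocity at 0 is
    computed in both ways. *)
Lemma right_field_translate (R : realType) (n : nat) (G : lieGroupType R n)
    (v : 'rV[R]_n) (q p : G) :
  tangent_map (fun q' : G => q' * q)%g p (right_field v p) = right_field v (p * q)%g.
Proof.
have [g [g0 gv]] := velocity_curve (1%g : G) v.
have := has_velocity_right q (right_field_velocity p g0 gv).
have := right_field_velocity (p * q)%g g0 gv.
have -> : (fun s => g s * (p * q))%g = (fun s => g s * p * q)%g.
  by apply/funext => s; rewrite mulgA.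
by rewrite g0 mul1g => /has_velocity_unique H /H.
Qed.

(** In coordinates the field is the derivative of the multiplication in its first argument at 1
    along [v], as a function of the second argument. *)
Lemma right_field_smooth (R : realType) (n : nat) (G : lieGroupType R n)
    (v : 'rV[R]_n) : smooth_vf (@right_field R n G v).
Proof.
move=> c ac k.
pose a := chart_at (1%g : G).
have aa : atlas a := chart_at_atlas 1%g.
have a1 : chart_dom a 1%g := chart_at_dom 1%g.
pose i (x : 'rV[R]_n) : 'rV[R]_(n + n) := row_mx (a 1%g) x.
pose f := (fun z => 'D_(row_mx v 0 : 'rV[R]_(n + n)) (chart_mul a c c) z) \o i.
have iP x : chart_im c x -> chart_mul_dom a c c (i x).
  move=> cx; have [cx1 cxE] := chart_imP cx.
  by rewrite /i -{1}cxE; apply: chart_mul_dom_map => //; rewrite mul1g.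
apply: (@Ck_ext _ _ _ _ _ f); first exact: chart_im_open.
  move=> x cx; have [cx1 cxE] := chart_imP cx; set p := chart_inv c x in cx1 cxE.
  have [g [g0 gv]] := velocity_curve (1%g : G) v.
  have pv := right_field_velocity p g0 gv.
  have cp : chart_dom c ((fun s => g s * p)%g 0) by rewrite g0 mul1g.
  have := has_velocity_chart ac cp pv; rewrite g0 mul1g => H1.
  rewrite /vf_rep -/p; apply: is_derive1_unique H1.
  have m1 : differentiable (chart_mul a c c) (i x).
    by rewrite /i -cxE; apply: chart_mul_differentiable => //; rewrite mul1g.
  rewrite /f /= deriveE // /i.
  have := @chart_mul_velocity _ _ _ a c c g (fun=> p) 0 v 0 aa ac ac.
  rewrite g0 mul1g cxE; apply=> //.
  - by case: gv.
  - exact: cvg_cst.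
  - by case: gv => _; rewrite g0.
  - exact: is_derive_cst.
have ci : continuous i := @row_mxr_continuous _ _ _ _.
apply: (Ck_subset iP).
apply: (@Ck_affine _ _ _ _ _ _ _ i (fun w => row_mx 0 w) ci) => [h w x|].
  by rewrite /i scale_row_mx add_row_mx scaler0 add0r.
(* One derivative is spent on the direction [(v, 0)], so class [k.+1] of the multiplication gives
   class [k]. *)
by have [_ /(_ (row_mx v 0))[_]] := chart_mul_smooth aa ac ac k.+1.
Qed.

Lemma right_field_invariant (R : realType) (n : nat) (G : lieGroupType R n)
    (v : 'rV[R]_n) : right_invariant (@right_field R n G v).
Proof.
by split=> [|q p]; [exact: right_field_smooth|exact: right_field_translate].
Qed.

(** * Invariant sets on manifolds *)

(** The velocity is two-sided but membership in [K] is asked only on the right, since the flow of a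
    linear field will be shown to preserve the subgroup for nonnegative times only. *)
Definition subtangent (R : realType) (n : nat) (M : manifoldType R n)
    (K : set M) (q : M) (v : 'rV[R]_n) : Prop :=
  exists k : R -> M, [/\ k 0 = q, has_velocity k 0 v & \forall h \near 0^'+, K (k h)].

(** [F] is a field in coordinates tied to [K] only at points of [K]. This covers both the
    coordinates of a vector field and a constant field whose solutions are straight lines. *)
Lemma nagumo_chart (R : realType) (n : nat) (M : manifoldType R n)
    (c : chart R n M) (K : set M) (p : M) (r L T : R)
    (F : 'rV[R]_n -> 'rV[R]_n) (x : R -> 'rV[R]_n) :
  atlas c -> closed K -> chart_dom c p -> K p -> 0 < r -> 0 <= L ->
  (forall y, `|y - c p| <= r -> chart_im c y) ->
  (forall y z, `|y - c p| <= r -> `|z - c p| <= r -> `|F y - F z| <= L * `|y - z|) ->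
  (forall q, K q -> chart_dom c q -> exists v, subtangent K q v /\
     'd (c \o chart_inv (chart_at q)) (chart_at q q) v = F (c q)) ->
  x 0 = c p ->
  (forall t, 0 <= t <= T -> {for t, continuous x} /\ `|x t - c p| <= r / 3) ->
  (forall t : R, 0 < t < T -> is_derive t 1 x (F (x t))) ->
  forall t, 0 <= t <= T -> K (chart_inv c (x t)).
Proof.
move=> ac Kcl cp Kp r0 L0 rc FL Ktan x0 xr dx.
apply: (@nagumo R n [set y | K (chart_inv c y)] (c p) r L T F x) => //.
(* Outside the chart image [chart_inv] is arbitrary, so the limit point is first placed in the
   closed ball. There [chart_inv] is continuous and closedness of [K] can be pulled back. *)
- move=> y yK.
  have yr : `|y - c p| <= r.
    rewrite leNgt; apply/negP => ry.
    have [z [[_ zr] yz]] := yK _ (nbhsx_ballx y _ (etrans (subr_gt0 _ _) ry)).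
    move: yz; rewrite -ball_normE /= ltNge => /negP; apply.
    by rewrite lerBlDr (le_trans (ler_distD z _ _)) // lerD2l.
  split=> //; apply: contrapT => nKy.
  have := chart_inv_nbhs (rc y yr) (open_nbhs_nbhs (conj (closed_openC Kcl) nKy)).
  by move=> /yK[z [[Kz _] [_ nKz]]].
- move=> y Ky yr; have [cq cqE] := chart_imP (rc y (ltW yr)).
  have [v [[k [k0 kv kK]] vF]] := Ktan _ Ky cq.
  have ck : chart_dom c (k 0) by rewrite k0.
  exists (c \o k); split; first by rewrite /= k0.
    by have := has_velocity_chart ac ck kv; rewrite k0 vF cqE.
  have near_c : \forall h \near (0 : R)^'+, chart_dom c (k h).
    by rewrite near_withinE; apply: filterS (chart_dom_near kv.1 ck).
  apply: filterS2 kK near_c.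
  by move=> h Kh ch; rewrite /= chart_mapK.
- by rewrite /= chart_mapK.
Qed.

Lemma tangent_open (R : realType) (n : nat) (M : manifoldType R n) (K : set M) :
  closed K -> (forall q v, K q -> subtangent K q v) -> open K.
Proof.
move=> Kcl Ktan; rewrite openE => p Kp.
pose c := chart_at p; have cp : chart_dom c p := chart_at_dom p.
have ac : atlas c := chart_at_atlas p.
have [r r0 rc] : exists2 r : R, 0 < r & forall y, `|y - c p| <= r -> chart_im c y.
  have /nbhs_ballP[r /= r0 rP] : nbhs (c p) (chart_im c).
    by apply: open_nbhs_nbhs; split; [exact: chart_im_open|exact: chart_im_map].
  exists (r / 2) => [|y yr]; first exact: divr_gt0.
  apply: rP; rewrite -ball_normE /= distrC (le_lt_trans yr) //.
  by rewrite ltr_pdivrMr // ltr_pMr // ltr1n.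
have ball_K y : `|y - c p| <= r / 3 -> K (chart_inv c y).
  move=> yr; pose x (t : R) := t *: (y - c p) + c p.
  have -> : y = x 1 by rewrite /x scale1r subrK.
  (* The constant field [y - c p] has Lipschitz constant 0 and its solution reaches [y] at time 1.
     It is tangent to [K] because every vector is. *)
  apply: (@nagumo_chart _ _ _ c K p r 0 1 (fun=> y - c p) x) => //.
  - by move=> y' z _ _; rewrite subrr normr0 mul0r.
  - move=> q Kq cq; exists ('d (chart_at q \o chart_inv c) (c q) (y - c p)).
    split; first exact: Ktan.
    by apply: transitionK => //; [exact: chart_at_atlas|exact: chart_at_dom].
  - by rewrite /x scale0r add0r.
  - move=> t /andP[t0 t1]; split.
      exact: is_derive1_continuous (is_derive1_line _ _ _).
    by rewrite /x addrK normrZ (ger0_norm t0) (le_trans _ yr) // ler_piMl.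
  - by move=> t _; exact: is_derive1_line.
  - by rewrite ler01 lexx.
have r3 : 0 < r / 3 by rewrite divr_gt0.
have /cvgrPdist_le /(_ _ r3) cont := chart_map_continuous cp.
have near_c : \forall q \near p, chart_dom c q.
  by apply: open_nbhs_nbhs; split; [exact: chart_dom_open|].
apply: filterS2 cont near_c => q; rewrite distrC => /ball_K + cq.
by rewrite chart_mapK.
Qed.

(** Real induction along the curve: closedness of [K] passes to limits from the left, and the chart
    version of Nagumo's theorem advances to the right. The field may change with [t] and governs
    only the open interval after [t], as switching controls require. *)
Lemma invariance (R : realType) (n : nat) (M : manifoldType R n) (K : set M)
    (g : R -> M) (T : R) :
  closed K -> continuous g -> K (g 0) ->
  (forall t, 0 <= t < T -> exists e (X : M -> 'rV[R]_n), [/\ 0 < e, smooth_vf X,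
     forall q, K q -> subtangent K q (X q) &
     forall s, t < s < t + e -> has_velocity g s (X (g s))]) ->
  forall t, 0 <= t <= T -> K (g t).
Proof.
move=> Kcl cg Kg0 gX; apply: real_induction => t /andP[t0 tT] IH.
  move: t0; rewrite le_eqVlt => /predU1P[<- //|t0].
  apply: contrapT => nKt.
  have : \forall s \near t, (~` K) (g s).
    by apply: cg; exact: (open_nbhs_nbhs (conj (closed_openC Kcl) nKt)).
  move=> H; near t^'- => s.
  have : (~` K) (g s) by near: s; rewrite near_withinE; apply: filterS H.
  apply; apply: IH; apply/andP; split; near: s.
    exact: nbhs_left_ge.
  exact: nbhs_left_lt.
have Kt : K (g t) by apply: IH; rewrite t0 lexx.
have [e [X [e0 sX Xtan gv]]] : exists e (X : M -> 'rV[R]_n), [/\ 0 < e, smooth_vf X,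
     forall q, K q -> subtangent K q (X q) &
     forall s, t < s < t + e -> has_velocity g s (X (g s))] by apply: gX; rewrite t0.
pose c := chart_at (g t); have cp : chart_dom c (g t) := chart_at_dom (g t).
have ac : atlas c := chart_at_atlas (g t).
have [r [L [r0 L0 rc FL]]] :=
  smooth_on_lipschitz (chart_im_open (c := c)) (chart_im_map cp) (sX c ac 1%N).
have r3 : 0 < r / 3 by rewrite divr_gt0.
have ccg s : chart_dom c (g s) -> {for s, continuous (c \o g)}.
  by move=> cgs; apply: continuous_comp; [exact: cg|exact: chart_map_continuous].
have [d d0 dP] : exists2 d : R, 0 < d & forall s, 0 <= s <= d ->
    chart_dom c (g (t + s)) /\ `|c (g (t + s)) - c (g t)| <= r / 3.
  have /cvgrPdist_le /(_ _ r3) H1 := ccg t cp.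
  have H2 := chart_dom_near (cg t) cp.
  have /nbhs_ballP[d /= d0 dP] : \forall s \near t,
      `|c (g t) - c (g s)| <= r / 3 /\ chart_dom c (g s) by exact: filterI.
  exists (d / 2) => [|s /andP[s0 sd]]; first exact: divr_gt0.
  have : ball t d (t + s) by rewrite /ball /= opprD addNKr normrN ger0_norm //; lra.
  by move=> /dP[]; rewrite distrC.
exists (Num.min d e); first by rewrite lt_min d0.
move=> s /andP[ts]; rewrite -ltrBlDl lt_min => /andP[sd se] _.
pose x (h : R) := c (g (t + h)).
have dx h : 0 <= h <= d -> {for h, continuous x}.
  move=> /dP[ch _]; apply: (@continuous_comp _ _ _ (fun h => t + h) (c \o g)).
    by apply: cvgD; [exact: cvg_cst|exact: cvg_id].
  exact: ccg.
have := @nagumo_chart _ _ _ c K (g t) r L (s - t) (vf_rep X c) x ac Kcl cp Kt r0 L0 rc FL.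
have hd h : 0 <= h <= s - t -> 0 <= h <= d by move=> /andP[h0 hs]; apply/andP; split; lra.
have st : 0 <= s - t <= s - t by rewrite lexx andbT subr_ge0 ltW.
have ts' : t + (s - t) = s by lra.
move=> /(_ _ _ _ _ _ st); rewrite /x ts' chart_mapK; last first.
  by have [] := dP _ (hd _ st); rewrite ts'.
apply.
- by move=> q Kq cq; exists (X q); split; [exact: Xtan|rewrite /vf_rep chart_mapK].
- by rewrite addr0.
- by move=> h /hd hd'; split; [exact: dx|case: (dP h hd')].
- move=> h /andP[h0 hs].
  have [ch _] : chart_dom c (g (t + h)) /\ `|c (g (t + h)) - c (g t)| <= r / 3.
    by apply: dP; apply/andP; split; lra.
  have gvh : has_velocity g (t + h) (X (g (t + h))) by apply: gv; apply/andP; split; lra.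
  have := has_velocity_rep ac ch gvh => /is_derive1_dist H; apply/is_derive1_dist => e' /H.
  by apply: filterS => k; rewrite /= addrA.
Unshelve. all: by end_near. Qed.

(** * Completeness of right-invariant vector fields *)

Lemma has_velocity_affine (R : realType) (n : nat) (M : manifoldType R n)
    (g : R -> M) (a b t : R) (v : 'rV[R]_n) :
  has_velocity g (a * t + b) v -> has_velocity (fun s => g (a * s + b)) t (a *: v).
Proof.
move=> [cg dg].
have dl : is_derive t 1 (fun s : R => a * s + b) a.
  have := @is_derive1_line _ R^o a b t; congr (is_derive t 1 _ _).
  by apply/funext => s; rewrite mulrC.
have cl := is_derive1_continuous dl.
split; first exact: (@continuous_comp _ _ _ (fun s => a * s + b) g).
case: (dg) => /derivable1_diffP dcg dv.
have := is_derive1_comp_diff dl dcg.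
have -> : 'd (chart_at (g (a * t + b)) \o g) (a * t + b) a = a *: v; last by [].
rewrite -dv deriveE // -linearZ; congr ('d _ _ _).
by rewrite [RHS]mulr1.
Qed.

Lemma has_velocity_glue (R : realType) (n : nat) (M : manifoldType R n)
    (g g1 g2 : R -> M) (t : R) (v : 'rV[R]_n) :
  g1 t = g2 t -> has_velocity g1 t v -> has_velocity g2 t v ->
  (\forall s \near t, (t <= s -> g s = g1 s) /\ (s < t -> g s = g2 s)) ->
  has_velocity g t v.
Proof.
move=> g12 [c1 d1] [c2 d2] gE.
have gt : g t = g1 t by have [/(_ (lexx _))] := nbhs_singleton gE.
have g2t : g t = g2 t by rewrite gt.
split.
  move=> A; rewrite {1}gt => A1; have A2 := A1; rewrite g12 in A2.
  have B1 : \forall s \near t, A (g1 s) by exact: c1.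
  have B2 : \forall s \near t, A (g2 s) by exact: c2.
  suff : \forall s \near t, A (g s) by [].
  apply: filterS3 B1 B2 gE => s s1 s2 [ts st].
  by have [/ts->|/st->] := lerP t s.
move: d1 d2; rewrite -gt -g2t => /is_derive1_dist d1 /is_derive1_dist d2.
apply/is_derive1_dist => e e0.
have gE0 : \forall h \near (0 : R), (t <= t + h -> g (t + h) = g1 (t + h)) /\
    (t + h < t -> g (t + h) = g2 (t + h)).
  have cl : t + h @[h --> (0 : R)] --> t.
    by rewrite -[X in _ --> X]addr0; apply: cvgD; [exact: cvg_cst|exact: cvg_id].
  exact: (cl _ gE).
apply: filterS3 (d1 e e0) (d2 e e0) gE0 => h h1 h2 [th ht] /=.
have [/th E|/ht E] := lerP t (t + h); rewrite E.
- by move: h1; rewrite /= -gt.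
- by move: h2; rewrite /= -g2t.
Qed.

Lemma local_integral_curve (R : realType) (n : nat) (G : lieGroupType R n)
    (Y : G -> 'rV[R]_n) : right_invariant Y ->
  exists (e : R) (g : R -> G), [/\ 0 < e, g 0 = 1%g &
    forall s, `|s| < e -> has_velocity g s (Y (g s))].
Proof.
move=> Yri; have [sY _] := Yri.
pose c := chart_at (1%g : G); have c1 : chart_dom c 1%g := chart_at_dom 1%g.
have ac : atlas c := chart_at_atlas 1%g.
have [r [L [r0 L0 rc FL]]] :=
  smooth_on_lipschitz (chart_im_open (c := c)) (chart_im_map c1) (sY c ac 1%N).
have [T [x [T0 xP]]] := ode_local_existence r0 L0 FL.
pose g := chart_inv c \o x.
have gv t : 0 < t < T -> has_velocity g t (Y (g t)).
  move=> tT; have [xr dx] := xP t tT.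
  have [cg cgE] := chart_imP (rc _ xr).
  apply: (rep_has_velocity ac cg).
    apply: continuous_comp; first exact: is_derive1_continuous dx.
    exact: chart_inv_continuous (rc _ xr).
  rewrite [c (g t)]cgE; apply: near_eq_is_derive dx.
  have : \forall s \near t, s \in `]0, T[ by exact: near_in_itvoo.
  apply: filterS => s; rewrite in_itv => /= sT.
  by have [xr' _] := xP s sT; have [_] := chart_imP (rc _ xr').
(* The forward solution is recentred at its middle time and translated by the inverse of the point
   reached there. It then passes through 1 at time 0 and is defined on both sides. *)
pose q := g (T / 2); exists (T / 2), (fun s => g (1 * s + T / 2) * q^-1)%g.
split; first exact: divr_gt0.
  by rewrite mulr0 add0r mulgV.
move=> s; rewrite ltr_norml => /andP[s1 s2].
apply: (@integral_curve_right _ _ _ Y (fun s => g (1 * s + T / 2))) => //.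
rewrite -[Y _]scale1r; apply: has_velocity_affine; apply: gv.
by apply/andP; split; lra.
Qed.

(** Integer powers, used to number the translated pieces of an integral curve on the whole line; the
    recursion [zexpgS] is what glues consecutive pieces. *)
Definition zexpg (G : groupType) (g : G) (k : int) : G :=
  match k with Posz m => (g ^+ m)%g | Negz m => (g ^- m.+1)%g end.

Lemma zexpgS (G : groupType) (g : G) (k : int) : zexpg g (k + 1) = (g * zexpg g k)%g.
Proof.
case: k => [m|[|m]].
- by rewrite (_ : Posz m + 1 = Posz m.+1) /= ?expgS //; lia.
- by rewrite (_ : Negz 0 + 1 = Posz 0) //= mulgV.
- rewrite (_ : Negz m.+1 + 1 = Negz m) /=; last by rewrite !NegzE; lia.
  by rewrite [in RHS]expgSr invgM mulgA mulgV mul1g.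
Qed.

(** On [[kT, (k+1)T)] the curve is [g (s - kT) * g(T)^k], a right translate of the local one. Since
    [e = 2T], each piece remains an integral curve beyond both ends of its interval, so neighbours
    can be glued differentiably; no group law for the curve is needed. *)
Lemma right_invariant_complete (R : realType) (n : nat) (G : lieGroupType R n)
    (Y : G -> 'rV[R]_n) : right_invariant Y ->
  exists g : R -> G, integral_curve Y g /\ g 0 = 1%g.
Proof.
move=> Yri; have [e [g [e0 g0 gv]]] := local_integral_curve Yri.
pose T := e / 2; have T0 : 0 < T by rewrite divr_gt0.
pose p := zexpg (g T).
pose b (k : int) (s : R) := (g (1 * s + - (k%:~R * T)) * p k)%g.
pose f s := b (Num.floor (s / T)) s.
have floorP (k : int) s : k%:~R * T <= s -> s < k%:~R * T + T -> f s = b k s.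
  move=> ks sk; rewrite /f; congr b; apply: floor_def.
  by rewrite ler_pdivlMr // ks ltr_pdivrMr // intrD mulrDl mul1r.
have bv (k : int) s : `|s - k%:~R * T| < e -> has_velocity (b k) s (Y (b k s)).
  move=> sk; apply: (@integral_curve_right _ _ _ Y (fun s => g (1 * s + - (k%:~R * T)))) => //.
  by rewrite -[Y _]scale1r; apply: has_velocity_affine; apply: gv; rewrite mul1r.
exists f; split; last first.
  rewrite (floorP 0) ?mul0r ?add0r // /b.
  by rewrite mulr0 mul0r oppr0 addr0 g0 mul1g.
move=> t; pose k := Num.floor (t / T).
have /andP[k1 k2] : k%:~R * T <= t < k%:~R * T + T.
  have := floor_itv (t / T); rewrite -/k ler_pdivlMr // ltr_pdivrMr //.
  by rewrite intrD mulrDl mul1r.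
have ft : f t = b k t by exact: floorP.
have bkv : has_velocity (b k) t (Y (f t)).
  by rewrite ft; apply: bv; rewrite ger0_norm; rewrite /T in k1 k2 *; lra.
have ltT : \forall s \near t, s < k%:~R * T + T by exact: lt_nbhsl.
move: k1; rewrite le_eqVlt => /predU1P[kt|kt]; last first.
  apply: (has_velocity_glue _ bkv bkv) => //.
  have gtT : \forall s \near t, k%:~R * T < s by exact: lt_nbhsr.
  by apply: filterS2 ltT gtT => s s1 s2; split=> _; apply: floorP => //; exact: ltW.
(* At [t = kT] the new piece starts at [g(T)^k] and the previous one ends at [g(T) * g(T)^(k-1)]. *)
have b2t : b k t = b (k - 1) t.
  rewrite /b -kt mul1r subrr g0 mul1g /p -{1}[k](subrK 1) zexpgS; congr (g _ * _)%g.
  by rewrite intrB; lra.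
apply: (has_velocity_glue b2t bkv).
  rewrite ft b2t; apply: bv; rewrite -kt intrB mulrBl mul1r opprB addrC subrK.
  by rewrite gtr0_norm // /T; lra.
have gtT : \forall s \near t, k%:~R * T - T < s by apply: lt_nbhsr; lra.
apply: filterS2 ltT gtT => s s1 s2; split=> st; apply: floorP;
  rewrite ?intrB ?mulrBl ?mul1r; lra.
Qed.

(** * The linearized flow at a fixed point *)

(** Among the matrices with row space inside [V] one has maximal rank; a vector of [V] outside its
    row space would increase that rank. *)
Lemma subspace_matrix (R : realType) (n : nat) (V : set 'rV[R]_n) :
  linear_subspace V -> exists B : 'M[R]_n, forall v, V v <-> (v <= B)%MS.
Proof.
move=> [V0 VD].
pose P k := `[< exists B : 'M[R]_n, (forall v : 'rV_n, (v <= B)%MS -> V v) /\ \rank B = k >].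
have P0 : exists k, P k.
  exists 0%N; apply/asboolP; exists 0; rewrite mxrank0; split=> // v.
  by rewrite submx0 => /eqP->.
have Pn k : P k -> (k <= n)%N by move=> /asboolP[B [_ <-]]; exact: rank_leq_row.
case: (ex_maxnP P0 Pn) => k /asboolP[B [BV Bk]] kmax.
exists B => v; split=> [Vv|]; last exact: BV.
apply: contrapT => /negP vB.
have BvV (w : 'rV_n) : (w <= B + v)%MS -> V w.
  move=> /sub_addsmxP[[u1 u2] /= ->].
  rewrite [u2]mx11_scalar mul_scalar_mx addrC; apply: VD => //.
  by apply: BV; exact: submxMl.
have : (\rank B < \rank (B + v)%MS)%N.
  apply: rank_ltmx; rewrite ltmxE addsmxSl /=; apply: contra vB.
  exact: submx_trans (addsmxSr _ _).
rewrite Bk ltnNge => /negP; apply; apply: kmax.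
by apply/asboolP; exists (B + v)%MS.
Qed.

Lemma mulmx_norm_bound (R : realType) (n m : nat) (D : 'M[R]_(n, m)) :
  exists2 N : R, 0 <= N & forall w : 'rV[R]_n, `|w *m D| <= N * `|w|.
Proof.
have cD : continuous (mulmxr D : {linear 'rV[R]_n -> 'rV[R]_m}).
  exact: linear_rV_continuous.
have [N N0 ND] := linear_lipschitz cD.
by exists N => [|w]; [exact: ltW|exact: ND].
Qed.

Lemma is_derive1_mulmx (R : realType) (n m : nat) (f : R -> 'rV[R]_n) (t : R)
    (v : 'rV[R]_n) (D : 'M[R]_(n, m)) :
  is_derive t 1 f v -> is_derive t 1 (fun s => f s *m D) (v *m D).
Proof.
move=> dv.
have cD : continuous (mulmxr D : {linear 'rV[R]_n -> 'rV[R]_m}).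
  exact: linear_rV_continuous.
have := is_derive1_comp_diff dv (linear_differentiable (f t) cD).
by rewrite diff_lin.
Qed.

(* The curve cannot leave the chart because it stays in the compact image of a
   closed ball, on which Gronwall's inequality improves the bound. *)
Lemma flow_bound (R : realType) (n : nat) (M : manifoldType R n)
    (X : M -> 'rV[R]_n) (c : chart R n M) (p : M) (r L T rho : R) (g : R -> M) :
  atlas c -> chart_dom c p -> 0 <= L ->
  vf_rep X c (c p) = 0 ->
  (forall y, `|y - c p| <= r -> chart_im c y) ->
  (forall y z, `|y - c p| <= r -> `|z - c p| <= r ->
     `|vf_rep X c y - vf_rep X c z| <= L * `|y - z|) ->
  integral_curve X g ->
  chart_dom c (g 0) -> `|c (g 0) - c p| <= rho -> rho * expR ((L + 1) * T) < r ->
  forall t, 0 <= t <= T ->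
    chart_dom c (g t) /\ `|c (g t) - c p| <= rho * expR ((L + 1) * T).
Proof.
move=> ac cp L0 Fp rc FL gX cg0 g0rho rhor.
pose f t := c (g t) - c p.
have rho0 : 0 <= rho by exact: le_trans g0rho.
have r0 : 0 < r by apply: le_lt_trans rhor; rewrite mulr_ge0 // ltW // expR_gt0.
have bound t : 0 <= t <= T -> (forall s, 0 <= s <= t -> chart_dom c (g s) /\ `|f s| <= r) ->
    `|f t| <= rho * expR ((L + 1) * T).
  move=> /andP[t0 tT] H.
  have cont s : 0 <= s <= t -> {for s, continuous (c \o g)}.
    by move=> /H[cs _]; apply: continuous_comp; [exact: (gX s).1|exact: chart_map_continuous].
  suff /(_ t) : forall s, 0 <= s <= t -> `|f s| <= (`|f 0| + 0) * expR ((L + 1) * s).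
    rewrite t0 lexx addr0 => /(_ isT)/le_trans; apply.
    by rewrite ler_pM ?normr_ge0 ?expR_ge0 // ler_expR ler_wpM2l //; lra.
  apply: (@gronwall_norm R _ f (fun s => vf_rep X c (c (g s))) L 0 t) => //.
  - by move=> s /cont cs; apply: cvgB => //; exact: cvg_cst.
  - move=> s /andP[s0 st].
    have [cs _] : chart_dom c (g s) /\ `|f s| <= r by apply: H; rewrite !ltW.
    have /is_derive1_dist dg := has_velocity_rep ac cs (gX s).
    apply/is_derive1_dist => e /dg; apply: filterS => h /=.
    by rewrite /f opprB [_ - c p + _]addrA subrK.
  - move=> s /andP[s0 st].
    have [cs fs] : chart_dom c (g s) /\ `|f s| <= r by apply: H; rewrite !ltW.
    (* Since the field vanishes at [c p], its norm at a point is at most [L] times the distance to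
       [c p]. *)
    by rewrite addr0 -[X in `|X|]subr0 -Fp; apply: FL => //; rewrite subrr normr0 ltW.
have Kc : closed (chart_inv c @` [set y | `|y - c p| <= r]).
  apply: compact_closed; first exact: manifold_hausdorff.
  apply: continuous_compact.
    apply: continuous_in_subspaceT => y; rewrite inE => yr.
    by apply: chart_inv_continuous; exact: rc.
  apply: bounded_closed_compact; first by apply: (@bounded_ball _ _ _ (c p) r).
  have -> : [set y | `|y - c p| <= r] = closed_ball_ Num.norm (c p) r.
    by apply/seteqP; split => y; rewrite /closed_ball_ /= distrC.
  exact: closed_closed_ball_.
have main : forall t, 0 <= t <= T -> chart_dom c (g t) /\ `|f t| < r.
  apply: real_induction => t /andP[t0 tT] IH.
    have : (chart_inv c @` [set y | `|y - c p| <= r]) (g t).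
      move: t0; rewrite le_eqVlt => /predU1P[t0|t0].
        have T0 : 0 <= T by rewrite t0.
        rewrite -t0; exists (c (g 0)); last by rewrite chart_mapK.
        rewrite /= (le_trans g0rho) // (le_trans _ (ltW rhor)) // ler_peMr //.
        by rewrite -[leLHS]expR0 ler_expR mulr_ge0 ?addr_ge0.
      apply: contrapT => nK.
      have : \forall s \near t, (~` (chart_inv c @` [set y | `|y - c p| <= r])) (g s).
        by apply: (gX t).1; exact: (open_nbhs_nbhs (conj (closed_openC Kc) nK)).
      move=> H; near t^'- => s.
      have : (~` (chart_inv c @` [set y | `|y - c p| <= r])) (g s).
        by near: s; rewrite near_withinE; apply: filterS H.
      apply; have [cs fs] : chart_dom c (g s) /\ `|f s| < r.
        apply: IH; apply/andP; split; near: s; first exact: nbhs_left_ge.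
        exact: nbhs_left_lt.
      by exists (c (g s)); [exact: ltW|exact: chart_mapK].
    move=> [y yr gty]; have [cy cyE] := chart_imP (rc y yr); rewrite gty in cy cyE.
    split=> //; apply: le_lt_trans rhor; apply: bound; first by rewrite t0.
    move=> s /andP[s0]; rewrite le_eqVlt => /predU1P[->|st].
      by rewrite /f cyE.
    by have [cs /ltW fs] : chart_dom c (g s) /\ `|f s| < r by apply: IH; rewrite s0.
  have [ct ft] : chart_dom c (g t) /\ `|f t| < r by apply: IH; rewrite t0 lexx.
  have H1 := chart_dom_near (gX t).1 ct.
  have H2 : \forall s \near t, `|f s| < r.
    have cont : {for t, continuous (fun s => `|f s|)}.
      apply: (@continuous_comp _ _ _ f); last exact: norm_continuous.
      apply: cvgB; last exact: cvg_cst.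
      by apply: continuous_comp; [exact: (gX t).1|exact: chart_map_continuous].
    exact: (cvgr_lt _ cont).
  have /nbhs_ballP[e /= e0 eP] : \forall s \near t, chart_dom c (g s) /\ `|f s| < r.
    exact: filterI.
  exists e => // s /andP[ts st] _; apply: eP.
  by rewrite /ball /= distrC gtr0_norm; lra.
move=> t tT; split; first by case: (main t tT).
apply: bound => // s /andP[s0 st]; have [|cs /ltW fs //] := main s.
by rewrite s0 (le_trans st) //; case/andP: tT.
Unshelve. all: by end_near. Qed.

Lemma vf_rep_center (R : realType) (n : nat) (M : manifoldType R n)
    (X : M -> 'rV[R]_n) (p : M) : vf_rep X (chart_at p) (chart_at p p) = X p.
Proof.
have [g [g0 gv]] := velocity_curve p (X p).
have gX : has_velocity g 0 (X (g 0)) by rewrite g0.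
have gp : chart_dom (chart_at p) (g 0) by rewrite g0; exact: chart_at_dom.
have := has_velocity_rep (chart_at_atlas p) gp gX; rewrite g0 => H1.
by have [_] := gv; rewrite g0 => H2; exact: is_derive1_unique H1 H2.
Qed.

(* The component of the solution transverse to [V] satisfies a linear
   differential inequality up to a second order error in the initial value. *)
Lemma linearized_flow_stable (R : realType) (n : nat) (M : manifoldType R n)
    (X : M -> 'rV[R]_n) (phi : R -> M -> M) (p : M) (V : set 'rV[R]_n) (T : R) :
  smooth_vf X -> (forall g, integral_curve X (phi^~ g)) -> (forall g, phi 0 g = g) ->
  0 <= T -> manifold_differentiable (phi T) p -> phi T p = p -> X p = 0 ->
  linear_subspace V ->
  (forall v, V v -> V ('d (vf_rep X (chart_at p)) (chart_at p p) v)) ->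
  forall v, V v -> V (tangent_map (phi T) p v).
Proof.
move=> sX phiX phi0 T0 dphi phip Xp Vlin VJ v Vv.
pose c := chart_at p; have cp : chart_dom c p := chart_at_dom p.
have ac : atlas c := chart_at_atlas p.
pose F := vf_rep X c; pose x0 := c p.
(* [C] is a linear map with kernel [V], so [w *m C] is the component of [w] transverse to [V]. *)
have [B BV] := subspace_matrix Vlin; pose C := cokermx B.
have CV w : V w <-> w *m C = 0.
  by split=> [/BV|wC]; [rewrite submxE => /eqP|apply/BV; rewrite submxE; apply/eqP].
(* [J] preserves the kernel of [C] and hence induces a map on the quotient. [D] is that map,
   computed by lifting with [pinvmx C]. *)
pose J := 'd F x0; pose D := pinvmx C *m lin1_mx J *m C.
have JD w : J w *m C = w *m C *m D.
  pose u := w - w *m C *m pinvmx C.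
  have : u *m C = 0 by rewrite mulmxBl mulmxKpV ?submxMl // subrr.
  move=> /CV/VJ/CV; rewrite -/c -/x0 -/F -/J /u linearB mulmxBl => /eqP.
  rewrite subr_eq0 => /eqP ->; rewrite /D -(mul_rV_lin1 J).
  by rewrite !mulmxA.
have C1F : Ck 1 (chart_im c) F by exact: sX.
have Fx0 : F x0 = 0 by rewrite /F /x0 vf_rep_center.
have [r [L [r0 L0 rc FL]]] :=
  smooth_on_lipschitz (chart_im_open (c := c)) (chart_im_map cp) C1F.
have dF : differentiable F x0.
  exact: (C1_differentiable (chart_im_open (c := c)) (chart_im_map cp) C1F).
have [NC NC0 NCP] := mulmx_norm_bound C; have [ND ND0 NDP] := mulmx_norm_bound D.
pose k := expR ((L + 1) * T); pose k' := expR ((ND + 1) * T).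
have k0 : 0 < k by exact: expR_gt0.
have k'0 : 0 < k' by exact: expR_gt0.
pose A := tangent_map (phi T) p v.
(* [e * Q] collects, per unit of [s], the initial transverse error, the nonlinear remainder along
   the flow (both amplified by [k']), and the error of the differential of [phi T]. *)
pose Q := (NC + NC * (`|v| + 1) * k) * k' + NC.
have Q0 : 0 <= Q.
  by rewrite addr_ge0 // mulr_ge0 ?(ltW k'0) // addr_ge0 // !mulr_ge0 ?addr_ge0 ?(ltW k0).
suff AQ e : 0 < e -> `|A *m C| <= e * Q.
  apply/CV; apply/eqP; rewrite -normr_le0; apply/ler_addgt0Pr => e e0; rewrite add0r.
  have e1 : 0 < e / (1 + Q) by rewrite divr_gt0 // ltr_pwDl.
  rewrite (le_trans (AQ _ e1)) // -mulrA ler_piMr ?(ltW e0) //.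
  by rewrite mulrC ler_pdivrMr ?ltr_pwDl // mul1r lerDr.
move=> e0.
have [d d0 dP] : exists2 d : R, 0 < d & forall w, `|w| < d -> `|F (w + x0) - J w| <= e * `|w|.
  have /nbhs_ballP[d /= d0 dP] := differentiable_dist dF e0.
  exists d => // w wd; have := dP w; rewrite -ball_normE /= sub0r normrN Fx0 subr0.
  by apply.
have [g [g0 gv]] := velocity_curve p v.
have g_dom : chart_dom c (g 0) by rewrite g0.
have gd : is_derive (0 : R) 1 (c \o g) v by move: gv => [_]; rewrite g0.
(* The bound by [e] makes the transverse part small; the bound by 1 keeps the starting point within
   [rho = s * (|v| + 1)] of [x0] whatever [e] is. *)
have e1 : 0 < Num.min e 1 by rewrite lt_min e0 ltr01.
have near_g : \forall s \near (0 : R)^'+, `|c (g s) - x0 - s *: v| <= Num.min e 1 * s.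
  move/is_derive1_dist : gd => /(_ _ e1) H; rewrite near_withinE; apply: filterS H.
  by move=> s /=; rewrite add0r g0 => H s0; rewrite -[X in _ * X](ger0_norm (ltW s0)).
have near_phi : \forall s \near (0 : R)^'+, `|c (phi T (g s)) - x0 - s *: A| <= e * s.
  have dphi0 : manifold_differentiable (phi T) (g 0) by rewrite g0.
  have [_] := has_velocity_comp dphi0 gv; rewrite /= g0 phip -/A -/c.
  move=> /is_derive1_dist /(_ _ e0) H; rewrite near_withinE; apply: filterS H.
  move=> s /=; rewrite add0r g0 phip => H s0.
  by rewrite -[X in _ * X](ger0_norm (ltW s0)).
have near_dom : \forall s \near (0 : R)^'+, chart_dom c (g s).
  by rewrite near_withinE; apply: filterS (chart_dom_near gv.1 g_dom).
have v1 : 0 < `|v| + 1 by rewrite ltr_wpDl.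
near (0 : R)^'+ => s.
have s0 : 0 < s by near: s; exact: nbhs_right_gt.
have gs : `|c (g s) - x0 - s *: v| <= Num.min e 1 * s by near: s.
have phis : `|c (phi T (g s)) - x0 - s *: A| <= e * s by near: s.
have doms : chart_dom c (g s) by near: s.
pose rho := s * (`|v| + 1).
have rhok : rho * k < Num.min r d.
  rewrite /rho -mulrA -ltr_pdivlMr ?mulr_gt0 //; near: s; apply: nbhs_right_lt.
  by rewrite divr_gt0 ?mulr_gt0 // lt_min r0.
move: rhok; rewrite lt_min => /andP[rhor rhod].
have phi_dom : chart_dom c (phi 0 (g s)) by rewrite phi0.
have min1 : Num.min e 1 * s <= s by rewrite ler_piMl ?(ltW s0) // ge_min lexx orbT.
have mine : Num.min e 1 * s <= e * s by rewrite ler_wpM2r ?(ltW s0) // ge_min lexx.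
have phi_rho : `|c (phi 0 (g s)) - x0| <= rho.
  rewrite phi0 -[_ - x0](subrK (s *: v)) (le_trans (ler_normD _ _)) //.
  by rewrite normrZ (gtr0_norm s0) /rho mulrDr mulr1 addrC lerD2l (le_trans gs).
have fb := flow_bound ac cp L0 Fx0 rc FL (phiX (g s)) phi_dom phi_rho rhor.
(* By [JD] the linear part of the equation closes up on the transverse component. Only the remainder
   of [F], at most [e * rho * k], acts as an inhomogeneous term. *)
pose h t := (c (phi t (g s)) - x0) *m C.
have dh t : 0 <= t <= T -> is_derive t 1 h (F (c (phi t (g s))) *m C).
  move=> /fb[ct _]; apply: is_derive1_mulmx.
  have /is_derive1_dist dg := has_velocity_rep ac ct (phiX (g s) t).
  apply/is_derive1_dist => e' /dg; apply: filterS => y /=.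
  by rewrite opprB [_ - x0 + _]addrA subrK.
have hT : `|h T| <= (`|h 0| + NC * (e * (rho * k))) * k'.
  have TT : 0 <= T <= T by rewrite T0 lexx.
  have e'0 : 0 <= NC * (e * (rho * k)).
    by rewrite !mulr_ge0 ?(ltW e0) ?(ltW k0) ?(ltW s0) ?(ltW v1).
  have H := @gronwall_norm _ _ h (fun t => F (c (phi t (g s))) *m C) ND _ T ND0 e'0.
  apply: H TT.
  - by move=> t /dh; exact: is_derive1_continuous.
  - by move=> t /andP[/ltW t0 /ltW t1]; apply: dh; rewrite t0.
  - move=> t /andP[/ltW t0 /ltW t1]; have [|ct ft] := fb t; first by rewrite t0.
    pose w := c (phi t (g s)) - x0.
    have wd : `|w| < d by exact: le_lt_trans rhod.
    have -> : F (c (phi t (g s))) = J w + (F (w + x0) - J w).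
      by rewrite /w subrK addrC subrK.
    rewrite mulmxDl JD (le_trans (ler_normD _ _)) // lerD ?NDP //.
    rewrite (le_trans (NCP _)) // ler_wpM2l // (le_trans (dP _ wd)) //.
    by rewrite ler_wpM2l ?(ltW e0).
(* The first order term [s *: v] disappears because [C] kills [V]. *)
have h0 : `|h 0| <= NC * (e * s).
  rewrite /h phi0; have -> : (c (g s) - x0) *m C = (c (g s) - x0 - s *: v) *m C.
    by rewrite [RHS]mulmxBl -scalemxAl (CV v).1 // scaler0 subr0.
  by rewrite (le_trans (NCP _)) // ler_wpM2l // (le_trans gs).
have sA : s * `|A *m C| <= s * (e * Q).
  rewrite -[X in X * _](gtr0_norm s0) -normrZ scalemxAl.
  have -> : s *: A *m C = h T - (c (phi T (g s)) - x0 - s *: A) *m C.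
    by rewrite /h -mulmxBl opprB addrC subrK.
  rewrite (le_trans (ler_normB _ _)) //.
  rewrite (le_trans (lerD hT (NCP _))) //.
  rewrite (le_trans (lerD (ler_wpM2r (ltW k'0) (lerD h0 (lexx _))) (ler_wpM2l NC0 phis))) //.
  by rewrite /Q /rho; lra.
by rewrite ler_pM2l in sA.
Unshelve. all: by end_near. Qed.

(** * Linear control systems *)

Lemma Ck_add (R : realType) (V W : normedModType R) k (U : set V) (f g : V -> W) :
  open U -> Ck k U f -> Ck k U g -> Ck k U (fun x => f x + g x).
Proof.
move=> oU; elim: k f g => [|k IH] f g [cf df] [cg dg]; split=> //.
- by move=> x Ux; apply: cvgD; [exact: cf|exact: cg].
- by move=> x Ux; apply: cvgD; [exact: cf|exact: cg].
move=> v; have [df1 df2] := df v; have [dg1 dg2] := dg v.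
split=> [x Ux|]; first exact: derivableD (df1 x Ux) (dg1 x Ux).
apply: Ck_ext oU _ (IH _ _ df2 dg2) => x Ux.
by rewrite deriveD //; [exact: df1|exact: dg1].
Qed.

Lemma vf_rep_linear (R : realType) (n : nat) (M : manifoldType R n)
    (a : R) (X Z : M -> 'rV[R]_n) (c : chart R n M) :
  vf_rep (a *: X + Z) c = fun x => a *: vf_rep X c x + vf_rep Z c x.
Proof.
apply/funext => x; pose p := chart_inv c x.
exact: (linearP ('d (c \o chart_inv (chart_at p)) (chart_at p p)) a (X p) (Z p)).
Qed.

Lemma smooth_vf_add (R : realType) (n : nat) (M : manifoldType R n)
    (X Z : M -> 'rV[R]_n) : smooth_vf X -> smooth_vf Z -> smooth_vf (X + Z).
Proof.
move=> sX sZ c ac k; rewrite -[X]scale1r vf_rep_linear.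
have -> : (fun x => 1 *: vf_rep X c x + vf_rep Z c x) = fun x => vf_rep X c x + vf_rep Z c x.
  by apply/funext => x; rewrite scale1r.
by apply: Ck_add; [exact: chart_im_open|exact: sX|exact: sZ].
Qed.

Lemma vf_rep_differentiable (R : realType) (n : nat) (M : manifoldType R n)
    (X : M -> 'rV[R]_n) (p : M) : smooth_vf X ->
  differentiable (vf_rep X (chart_at p)) (chart_at p p).
Proof.
move=> sX; apply: (C1_differentiable (chart_im_open (c := chart_at p))).
  exact: chart_im_map (chart_at_dom p).
exact: sX (chart_at_atlas p) 1%N.
Qed.

Lemma diff_linear_comb (R : realType) (V W : normedModType R) (f g : V -> W)
    (a : R) (x v : V) : differentiable f x -> differentiable g x ->
  'd (fun y => a *: f y + g y) x v = a *: 'd f x v + 'd g x v.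
Proof.
move=> df dg; have -> : (fun y => a *: f y + g y) = a *: f + g by [].
by rewrite diffD ?diffZ //; exact: differentiableZ.
Qed.

Lemma derivation_linear (R : realType) (n : nat) (G : lieGroupType R n)
    (X W Z : G -> 'rV[R]_n) (a : R) :
  smooth_vf W -> smooth_vf Z ->
  derivation X (a *: W + Z) = a *: derivation X W + derivation X Z.
Proof.
move=> sW sZ; apply/funext => p.
have dW := vf_rep_differentiable p sW; have dZ := vf_rep_differentiable p sZ.
pose c := chart_at p; pose x := c p; pose v := vf_rep X c x.
pose f := 'd (vf_rep X c) x; pose w := vf_rep W c x; pose z := vf_rep Z c x.
have E1 := vf_rep_linear a W Z c.
have E2 : 'd (vf_rep (a *: W + Z) c) x v = a *: 'd (vf_rep W c) x v + 'd (vf_rep Z c) x v.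
  by rewrite E1; exact: diff_linear_comb.
have E3 : f (vf_rep (a *: W + Z) c x) = a *: f w + f z.
  by rewrite E1; exact: (linearP f a w z).
have E : bracket X (a *: W + Z) p = a *: bracket X W p + bracket X Z p.
  transitivity (a *: 'd (vf_rep W c) x v + 'd (vf_rep Z c) x v - (a *: f w + f z)).
    exact: (congr2 (fun s t : 'rV[R]_n => s - t) E2 E3).
  by rewrite opprD addrACA -scalerBr.
transitivity (- bracket X (a *: W + Z) p) => //.
by rewrite E opprD -scalerN.
Qed.

(** Where [X] vanishes the term differentiating [W] drops out of the bracket. The derivation then
    acts on the value [W p] alone, as the linearization of [X]. *)
Lemma derivation_zero (R : realType) (n : nat) (G : lieGroupType R n)
    (X W : G -> 'rV[R]_n) (p : G) :
  X p = 0 -> derivation X W p = 'd (vf_rep X (chart_at p)) (chart_at p p) (W p).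
Proof.
move=> Xp; pose c := chart_at p; pose x := c p.
pose f := 'd (vf_rep W c) x; pose g := 'd (vf_rep X c) x.
have E1 : f (vf_rep X c x) = 0 by rewrite /x vf_rep_center Xp; exact: (linear0 f).
have E2 : g (vf_rep W c x) = g (W p) by rewrite /x vf_rep_center.
have E : bracket X W p = 0 - g (W p).
  exact: (congr2 (fun s t : 'rV[R]_n => s - t) E1 E2).
by transitivity (- bracket X W p) => //; rewrite E sub0r opprK.
Qed.

Lemma linear_subspace_smallest (R : realType) (V : lmodType R) (S : set V) :
  linear_subspace (smallest (@linear_subspace R V) S).
Proof.
split=> [L [[L0 _] _]|a x y Sx Sy L LS]; first exact: L0.
have [[_ LD] _] := LS.
by apply: LD; [exact: Sx|exact: Sy].
Qed.

Lemma linear_subspace_scale (R : realType) (V : lmodType R) (L : set V) (a : R) (x : V) :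
  linear_subspace L -> L x -> L (a *: x).
Proof. by move=> [L0 LD] Lx; rewrite -[_ *: _]addr0; exact: LD. Qed.

Lemma linear_subspace_sum (R : realType) (V : lmodType R) (L : set V) (m : nat)
    (f : 'I_m -> V) (a : 'I_m -> R) :
  linear_subspace L -> (forall j, L (f j)) -> L (\sum_(j < m) a j *: f j).
Proof.
move=> [L0 LD] Lf; apply: (big_ind L) => // [x y Lx Ly|j _].
  by rewrite -[x]scale1r; exact: LD.
by apply: linear_subspace_scale; first by split.
Qed.

Lemma closed_subgroup_generatedP (R : realType) (n : nat) (G : lieGroupType R n)
    (S : set G) :
  closed (closed_subgroup_generated S) /\ subgroup_set (closed_subgroup_generated S).
Proof.
split.
  by apply: closed_bigI => A [[]].
split=> [A [[_ []]] //|x y Sx Sy A AS].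
by have [[_ [_ AD]] _] := AS; apply: AD; [exact: Sx|exact: Sy].
Qed.

Lemma subgroup_set_mul (G : groupType) (K : set G) (x y : G) :
  subgroup_set K -> K x -> K y -> K (x * y)%g.
Proof.
move=> [K1 KD] Kx Ky; have Ky' : K (y^-1)%g by rewrite -[(y^-1)%g]mul1g; exact: KD.
by rewrite -[y]invgK; exact: KD.
Qed.

Lemma exp_set_curve (R : realType) (n : nat) (G : lieGroupType R n)
    (L : set (G -> 'rV[R]_n)) (Y : G -> 'rV[R]_n) (g : R -> G) (t : R) :
  linear_subspace L -> L Y -> integral_curve Y g -> g 0 = 1%g -> exp_set L (g t).
Proof.
move=> Llin LY gY g0; exists (t *: Y), (fun s => g (t * s + 0)); split.
- exact: linear_subspace_scale.
- by move=> s; apply: has_velocity_affine; exact: gY.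
- by rewrite mulr0 addr0.
- by rewrite mulr1 addr0.
Qed.

Lemma morph_mul1 (G : groupType) (a : G -> G) :
  {morph a : x y / (x * y)%g} -> a 1%g = 1%g.
Proof. by move=> aM; apply: (mulgI (a 1%g)); rewrite -aM !mulg1. Qed.

Lemma morph_div (G : groupType) (a : G -> G) (x y : G) :
  {morph a : x y / (x * y)%g} -> a (x / y)%g = (a x / a y)%g.
Proof. by move=> aM; apply: (mulIg (a y)); rewrite -aM !mulgVK. Qed.

(** [a (k s * q) = a (k s) * a q], so the image curve is again a right translate of a curve through
    1. An automorphism thus acts on right-invariant fields through its differential at 1. *)
Lemma automorphism_right_field (R : realType) (n : nat) (G : lieGroupType R n)
    (a : G -> G) (v : 'rV[R]_n) (q : G) :
  {morph a : x y / (x * y)%g} -> smooth_map a ->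
  tangent_map a q (right_field v q) = right_field (tangent_map a 1%g v) (a q).
Proof.
move=> aM sa; have [k [k0 kv]] := velocity_curve (1%g : G) v.
have kq := right_field_velocity q k0 kv.
have H1 := has_velocity_comp (smooth_map_differentiable (k 0 * q)%g sa) kq.
have H2 := has_velocity_comp (smooth_map_differentiable (k 0) sa) kv.
have ak0 : (a \o k) 0 = 1%g by rewrite /= k0 morph_mul1.
have H3 := right_field_velocity (a q) ak0 H2.
have E : (fun s => (a \o k) s * a q)%g = a \o (fun s => k s * q)%g.
  by apply/funext => s; rewrite /= aM.
rewrite E in H3; have := has_velocity_unique H1 H3.
by rewrite k0 mul1g.
Qed.

Lemma right_field_onto (R : realType) (n : nat) (G : lieGroupType R n)
    (q : G) (v : 'rV[R]_n) : exists w, right_field w q = v.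
Proof.
have [k [k0 kv]] := velocity_curve q v.
have H := has_velocity_right (q^-1)%g kv.
have k1 : (k 0 * q^-1)%g = 1%g by rewrite k0 mulgV.
exists (tangent_map (fun q' => q' * q^-1)%g (k 0) v).
have := @right_field_velocity _ _ _ (fun s => k s * q^-1)%g _ q k1 H.
have -> : (fun s => k s * q^-1 * q)%g = k by apply/funext => s; rewrite mulgVK.
by move/has_velocity_unique; apply.
Qed.

Lemma connected_clopen_full (T : topologicalType) (K : set T) (x : T) :
  connected [set: T] -> open K -> closed K -> K x -> K = setT.
Proof.
move=> Tc oK cK Kx; apply: Tc; first by exists x.
- by exists K => //; rewrite setTI.
- by exists K => //; rewrite setTI.
Qed.

Lemma piecewise_constant_right (R : realType) (T : Type) (u : R -> T) (t : R) :
  piecewise_constant u ->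
  exists2 e, 0 < e & exists w, forall s, t < s < t + e -> u s = w.
Proof.
move=> /(_ t (t + 1))[S uS].
(* [t + e] does not pass the first listed break point after [t], and [e <= 1] keeps the interval in
   the window [[t, t + 1]] covered by the list. The value is then sampled at the midpoint, as [u t]
   may be a break value. *)
have [e [e0 e1 eS]] : exists e, [/\ 0 < e, e <= 1 & forall z, z \in S -> z <= t \/ t + e <= z].
  elim: S {uS} => [|z S [e [e0 e1 eS]]]; first by exists 1; split.
  have [zt|tz] := lerP z t.
    exists e; split=> // z'; rewrite inE => /predU1P[->|/eS //]; by left.
  exists (Num.min e (z - t)); split; first by rewrite lt_min e0 subr_gt0.
    by rewrite ge_min e1.
  move=> z'; rewrite inE => /predU1P[->|/eS[|z't]]; [right|by left|right].
    by rewrite -lerBrDl ge_min lexx orbT.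
  by rewrite (le_trans _ z't) // lerD2l ge_min lexx.
exists e => //; exists (u (t + e / 2)) => s /andP[ts se].
have const x y : t < x -> x <= y -> y < t + e -> u x = u y.
  move=> tx xy ye; apply: uS => //; [exact: ltW|lra|].
  by move=> z /eS[zt|tz]; apply/negP => /andP[xz zy]; lra.
have [st|/ltW ts'] := lerP s (t + e / 2); first by apply: const => //; lra.
by apply/esym; apply: const => //; lra.
Qed.

Section LinearControlSystem.
Variables (R : realType) (n m : nat) (G : lieGroupType R n).
Variables (X : G -> 'rV[R]_n) (Y : 'I_m -> G -> 'rV[R]_n).
Hypothesis X_linear : linear_vf X.
Hypothesis Lie_H : lie_algebra_of (group_H X Y) = sub_h X Y.

Let Da := sub_Da X Y.
Let H := group_H X Y.

(** [Lie_H] is the source of right invariance here. Being an intersection, [smallest] bounds its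
    elements only once some subalgebra containing the generators is exhibited. *)
Lemma sub_h_curve Z : sub_h X Y Z -> right_invariant Z /\
  exists g, [/\ integral_curve Z g, g 0 = 1%g & forall t, H (g t)].
Proof. by rewrite -Lie_H. Qed.

Lemma sub_Da_sub_h Z : Da Z -> sub_h X Y Z.
Proof. exact: sub_gen_smallest. Qed.

Lemma sub_Da_right_invariant Z : Da Z -> right_invariant Z.
Proof. by move=> /sub_Da_sub_h /sub_h_curve[]. Qed.

Lemma sub_Da_subspace : linear_subspace Da.
Proof. exact: linear_subspace_smallest. Qed.

Lemma sub_Da_derivation Z : Da Z -> Da (derivation X Z).
Proof.
(* Membership in [Da] is kept in [L] because it provides the smoothness under which the derivation
   is linear. *)
pose L := [set W | Da W /\ Da (derivation X W)].
have smooth_Da W : Da W -> smooth_vf W by move=> /sub_Da_right_invariant[].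
have D0 := sub_Da_subspace.1; have DD := sub_Da_subspace.2.
suff : Da `<=` L by move=> DL /DL[].
apply: smallest_sub.
  split=> [|a W W' [DW dW] [DW' dW']].
    (* Linearity at [-1 *: 0 + 0] gives that the derivation of 0 is 0. *)
    split=> //; have := derivation_linear X (-1) (smooth_Da _ D0) (smooth_Da _ D0).
    by rewrite scaler0 addr0 scaleN1r addNr => ->.
  split; first exact: DD.
  by rewrite derivation_linear; [exact: DD|exact: smooth_Da|exact: smooth_Da].
move=> _ [i [Z' [aZ' ->]]]; split; apply: sub_gen_smallest.
  by exists i, Z'.
by exists i.+1, Z'.
Qed.

(* Using [Da] instead of the subalgebra [h] avoids having to know that [h] is
   invariant under [D], i.e. the Jacobi identity. *)
Let K := closed_subgroup_generated (exp_set Da).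

Lemma K_sub_H : K `<=` H.
Proof.
have [Hcl Hgr] := closed_subgroup_generatedP (exp_set (sub_h X Y)).
apply: smallest_sub => // g [Z [k [DZ kZ k0 k1]]].
by apply: sub_gen_smallest; exists Z, k; split=> //; exact: sub_Da_sub_h.
Qed.

Lemma flow_K (phi : R -> G -> G) :
  (forall g, integral_curve X (phi^~ g)) -> (forall g, phi 0 g = g) ->
  (forall t, lie_automorphism (phi t)) ->
  forall t g, 0 <= t -> K g -> K (phi t g).
Proof.
move=> phiX phi0 phiA t g t0; have [Kcl Kgr] := closed_subgroup_generatedP (exp_set Da).
have phiM s : {morph phi s : x y / (x * y)%g} by case: (phiA s).
have phi1 s : phi s 1%g = 1%g by exact: morph_mul1.
have phi_smooth : smooth_map (phi t) by case: (phiA t).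
(* Automorphisms fix 1, so the integral curve through 1 is constant. *)
have X1 : X 1%g = 0.
  have cst_v : has_velocity (fun=> (1%g : G)) 0 (0 : 'rV[R]_n).
    by split; [exact: cvg_cst|exact: is_derive_cst].
  have := phiX 1%g 0; rewrite phi1.
  have -> : phi^~ 1%g = fun=> (1%g : G) by apply/funext => s; rewrite phi1.
  by move/has_velocity_unique; apply.
have sX : smooth_vf X by case: X_linear.
pose V := [set W 1%g | W in Da].
have Vlin : linear_subspace V.
  have [D0 DD] := sub_Da_subspace; split; first by exists 0.
  by move=> a _ _ [W DW <-] [W' DW' <-]; exists (a *: W + W') => //; exact: DD.
have VJ v : V v -> V ('d (vf_rep X (chart_at 1%g)) (chart_at (1%g : G) 1%g) v).
  move=> [W DW <-]; exists (derivation X W); first exact: sub_Da_derivation.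
  exact: derivation_zero.
have Vt v : V v -> V (tangent_map (phi t) 1%g v).
  apply: (linearized_flow_stable sX phiX phi0 t0 _ (phi1 t) X1 Vlin VJ).
  exact: smooth_map_differentiable.
(* The preimage of [K] is a closed subgroup, so generators suffice. [phi t] maps the integral curve
   of [W] to that of the field [W'] of [Da] whose value at 1 is the image of [W 1]. *)
suff : K `<=` phi t @^-1` K by apply.
apply: smallest_sub.
  split; first by apply: preimage_closed => // x _; exact: phi_smooth.1.
  split=> [|x y Kx Ky]; first by rewrite /= phi1; exact: Kgr.1.
  by rewrite /= morph_div //; exact: Kgr.2.
move=> _ [W [k [DW kW k0 <-]]].
have [|W' DW' W'1] := Vt (W 1%g); first by exists W.
apply: sub_gen_smallest; exists W', (phi t \o k); split=> //; last by rewrite /= k0.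
move=> s; have := has_velocity_comp (smooth_map_differentiable (k s) phi_smooth) (kW s).
rewrite (right_invariantE (sub_Da_right_invariant DW)) automorphism_right_field //.
by rewrite -W'1 -(right_invariantE (sub_Da_right_invariant DW')).
Qed.

Lemma K_subtangent Z q : Da Z -> K q -> subtangent K q ((X + Z) q).
Proof.
move=> DZ Kq; have [_ Kgr] := closed_subgroup_generatedP (exp_set Da).
have [_ [phi [phiX phi0 _ phiA]]] := X_linear.
have [Zri [g [gZ g0 _]]] := sub_h_curve (sub_Da_sub_h DZ).
(* The product rule applies at time 0 because [g 0 = 1]. For [h >= 0] both factors lie in [K], the
   first as an exponential and the second by [flow_K]. *)
exists (fun s => g s * phi s q)%g; split; first by rewrite g0 mul1g.
  have := has_velocity_mul g0 (gZ 0) (phiX q 0); rewrite phi0 g0.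
  rewrite -/(right_field (Z 1%g) q) -(right_invariantE Zri) addrC.
  by apply.
near=> h.
have h0 : 0 <= h by near: h; exact: nbhs_right_ge.
apply: (@subgroup_set_mul G K) => //.
  apply: sub_gen_smallest; apply: exp_set_curve gZ g0 => //; exact: sub_Da_subspace.
exact: (flow_K phiX phi0 phiA).
Unshelve. all: by end_near. Qed.

Lemma solution_H (u : R -> 'rV[R]_m) (g : R -> G) (t : R) :
  piecewise_constant u -> solution X Y u g -> g 0 = 1%g -> 0 <= t -> H (g t).
Proof.
move=> upc [cg gu] g0 t0; have [Kcl Kgr] := closed_subgroup_generatedP (exp_set Da).
apply: K_sub_H; apply: (@invariance _ _ _ K g t) => //.
- by rewrite g0; exact: Kgr.1.
(* Just after [s] the control has one value [w], and the corresponding combination of the [Y j] lies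
   in [Da] already with exponent 0 of the derivation. *)
- move=> s _; have [e e0 [w uw]] := piecewise_constant_right s upc.
  pose Z := \sum_(j < m) w 0 j *: Y j.
  have DZ : Da Z.
    apply: linear_subspace_sum => [|j]; first exact: sub_Da_subspace.
    apply: sub_gen_smallest; exists 0%N, (Y j); split=> //.
    by apply: sub_gen_smallest; exists j.
  have [sZ _] := sub_Da_right_invariant DZ.
  exists e, (X + Z); split=> //.
  + by apply: smooth_vf_add => //; case: X_linear.
  + by move=> q; exact: K_subtangent.
  (* Every [r] in the open interval has a neighbourhood on which [u] is constant, so the equation
     holds at [r]; nothing is claimed at the switching time [s]. *)
  move=> r sr; have /gu : \forall r' \near r, u r' = u r.
    have near_r : \forall r' \near r, r' \in `]s, s + e[ by exact: near_in_itvoo.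
    by apply: filterS near_r => r'; rewrite in_itv => /= /uw ->; rewrite uw.
  rewrite uw //; congr has_velocity.
  by rewrite /system_vf [(X + Z) _]/(_ + _) /Z fct_sumE.
- by rewrite t0 lexx.
Qed.

Lemma H_full_Lie : H = setT -> sub_h X Y = @lie_algebra R n G.
Proof.
move=> HT; rewrite -Lie_H; apply/seteqP; split=> [Z []//|Z Zri]; split=> //.
have [g [gZ g0]] := right_invariant_complete Zri.
by exists g; split=> // t; rewrite -/H HT.
Qed.

Lemma Lie_full_H : connected [set: G] -> sub_h X Y = @lie_algebra R n G -> H = setT.
Proof.
move=> Gc hT; have [Hcl Hgr] := closed_subgroup_generatedP (exp_set (sub_h X Y)).
apply: (@connected_clopen_full _ H 1%g) => //; last exact: Hgr.1.
apply: (@tangent_open R n G) => // q v Hq.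
have [w <-] := right_field_onto q v.
have [|Yri [g [gY g0 gH]]] := @sub_h_curve (right_field w).
  by rewrite hT; exact: right_field_invariant.
exists (fun s => g s * q)%g; split.
- by rewrite g0 mul1g.
- by have := integral_curve_right q Yri (gY 0); rewrite g0 mul1g.
- by apply: filterS filterT => s _; exact: (@subgroup_set_mul G H).
Qed.

End LinearControlSystem.

Theorem theorem4p3 (R : realType) (n m : nat) (G : lieGroupType R n)
    (X : G -> 'rV[R]_n) (Y : 'I_m -> G -> 'rV[R]_n) (U : set 'rV[R]_m)
    (G_connected : connected [set: G])
    (X_linear : linear_vf X)
    (Y_right_invariant : forall j, right_invariant (Y j))
    (Lie_H : lie_algebra_of (group_H X Y) = sub_h X Y) :
  [/\ group_H X Y `<` [set: G] -> ~ controllable X Y U,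
      sub_h X Y `<` @lie_algebra R n G -> ~ controllable X Y U &
      group_H X Y `<` [set: G] <-> sub_h X Y `<` @lie_algebra R n G].
Proof.
have H_g : group_H X Y `<` [set: G] <-> sub_h X Y `<` @lie_algebra R n G.
  split=> -[sub nsub]; split=> //.
  - by rewrite -Lie_H => Z [].
  - move=> gh; apply: nsub; rewrite (Lie_full_H Lie_H G_connected) //.
    by apply/seteqP; split=> //; rewrite -Lie_H => Z [].
  - by move=> GH; apply: nsub; rewrite (H_full_Lie Lie_H) //; exact/seteqP.
have not_ctrl : group_H X Y `<` [set: G] -> ~ controllable X Y U.
  (* Controllability is used from the start point 1 only: it would place every [h] on a solution
     confined to [H]. *)
  move=> [_ nsub] ctrl; apply: nsub => h _.
  have [t [u [g [t0 [upc _] sol g0 <-]]]] := ctrl 1%g h.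
  exact: (solution_H X_linear Lie_H upc sol g0 t0).
by split=> // /H_g.
Qed.
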